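(* Let $\mathcal{G}$ be a finite non-trivial group, $P=P(\mathcal{G})$ its group planar algebra, $(A_G^3,\tau_G)$ the graded algebra with its trace in the two-sided Guionnet-Jones-Shlyakhtenko construction at level $3$, $Z\in P_{(5,+)}\subset A_G^3$ the distinguished self-adjoint Temperley-Lieb element described in the context, and $\mathcal{C}=\langle Z\rangle$ the unital $*$-subalgebra of $A_G^3$ generated by $Z$. Then the subalgebras $\mathcal{C}$ and $P_{(3,+)}$ are free in $(A_G^3,\tau_G)$.
   Context: **Group planar algebra.** For a finite group $\mathcal{G}$ of order $n$, $P(\mathcal{G})$ is the group planar algebra: the irreducible subfactor planar algebra with modulus $\delta=\sqrt n$ associated with the fixed-point subfactor $R^{\mathcal G}\subset R$ of an outer action of $\mathcal G$ on the hyperfinite $II_1$ factor $R$. It has $P_{(2,+)}=\mathbb{C}\mathcal{G}$ (stacking of 2-boxes is group multiplication, $g^*=g^{-1}$, the identity tangle is $e$) and $\dim P_{(k,\pm)}=n^{k-1}$ for $k\ge 1$. A concrete model: $P_{(k,+)}$ ($k\ge1$) consists of the functions $\mathcal{G}^k\to\mathbb{C}$ invariant under diagonal left translation, where a $(k,+)$-box has $2k$ boundary points, its marked boundary interval is unshaded, and the $k$ arguments are spins on its $k$ shaded boundary intervals. A tangle, drawn with all boxes rectangular with half of their points on top, half on the bottom and the marked interval at the left, acts by summing over assignments of elements of $\mathcal{G}$ to internal shaded regions (spins on regions touching the external boundary being the arguments of the output) the product of the values of the box labels, times a factor $n^{-1/4}$ (resp. $n^{1/4}$) for each local maximum or minimum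 of a string whose concave side is shaded (resp. unshaded). The adjoint $*$ is mirror reflection with complex conjugation. $P_{(0,\pm)}=\mathbb{C}$, and each closed loop contributes $\delta$. **Graded algebra $A_G^k$.** For $k\ge0$, $A_G^k=\bigoplus_{m\ge0}A^k_m$ with $A^k_m=P_{(2m+k,+)}$. An element of $A^k_m$ is drawn as a box with $k$ strings on the left side, $k$ on the right side, $2m$ on the top and $2m$ on the bottom, with marked interval at the top-left corner. The graded product of $a\in A^k_m$ and $b\in A^k_{m'}$ is the concatenation $a\cdot b\in A^k_{m+m'}$: place $a$ to the left of $b$ and join the $k$ right strings of $a$ to the $k$ left strings of $b$, the top (bottom) strings of $a$ followed by those of $b$ becoming the top (bottom) strings of the product. The involution $\dagger$ is, on each $A^k_m$, the planar algebra adjoint (mirror reflection exchanging left and right) followed by the rotation returning the marked interval to the top-left corner. In particular $P_{(3,+)}=A^3_0$ is a unital subalgebra of $A^3_G$. **Trace.** Let $TL(m)$ be the set of Temperley-Lieb (non-crossing pairing) diagrams on $2m$ boundary points. For $a\in A^k_m$, $\tau_G(a)=\delta^{-k}\sum_{T\in TL(m)}\langle a\rangle_T$, where $\langle a\rangle_T\in\mathbb{C}$ is the value of the closed diagram obtained by connecting the $2m$ top strings of $a$ according to $T$, the $2m$ bottom strings according to the mirror image of $T$ in a horizontal axis, and joining the $k$ right strings to the $k$ left strings by parallel strings going around. Extended linearly, $\tau_G$ is a faithful tracial state on $A_G^k$. **The element $Z$.** $Z\in A^3_1=P_{(5,+)}$ is the Temperley-Lieb diagram in which, with left points $L_1,L_2,L_3$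 and right points $R_1,R_2,R_3$ numbered from top to bottom, top points $T_1,T_2$ and bottom points $B_1,B_2$ numbered from left to right, the strings join $L_1$–$T_1$, $T_2$–$R_1$, $L_2$–$R_2$, $L_3$–$B_1$, $B_2$–$R_3$. **Freeness.** Unital subalgebras $A_i$ of $(A,\varphi)$ are free if $\varphi(a_1\cdots a_q)=0$ whenever $q\ge1$, $a_j\in A_{i_j}$, $\varphi(a_j)=0$, and $i_j\ne i_{j+1}$ for all $j<q$. *)

(* Defs.v *)
From HB Require Import structures.
From mathcomp Require Import all_boot all_order all_algebra all_fingroup.
From mathcomp Require Import complex boolp classical_sets fsbigop reals.
From mathcomp Require Import ring zify.

Set Implicit Arguments.
Unset Strict Implicit.
Unset Printing Implicit Defensive.

Import GRing.Theory Num.Theory.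
Local Open Scope ring_scope.

Section GroupPlanarAlgebra.

Variables (C : numClosedFieldType) (G : finGroupType).

Definition translate k (g : G) (t : k.-tuple G) : k.-tuple G :=
  map_tuple (mulg g) t.

Lemma translateK k g : cancel (@translate k g) (translate g^-1).
Proof.
move=> t; apply/val_inj; rewrite /= -map_comp -[RHS]map_id.
by apply: eq_map => x /=; rewrite mulKg.
Qed.

Lemma translate_bij k g : bijective (@translate k g).
Proof.
exists (translate g^-1); first exact: translateK.
by move=> t; rewrite -{1}[g]invgK translateK.
Qed.

Definition translation_invariant k : {pred {ffun k.-tuple G -> C^o}} :=
  fun f => [forall g, forall t, f (translate g t) == f t].

Lemma translation_invariantP k (f : {ffun k.-tuple G -> C^o}) :
  reflect (forall g t, f (translate g t) = f t) (f \in @translation_invariant k).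
Proof.
by apply: (iffP forallP) => [+ g t|+ g] => [/(_ g)/forallP/(_ t)/eqP|fi] //;
  apply/forallP => t; rewrite fi.
Qed.

Fact translation_invariant_submod k : submod_closed (@translation_invariant k).
Proof.
split=> [|a u v /translation_invariantP ui /translation_invariantP vi].
  by apply/translation_invariantP => g t; rewrite !ffunE.
by apply/translation_invariantP => g t; rewrite !ffunE ui vi.
Qed.

HB.instance Definition _ k := GRing.isSubmodClosed.Build C
  {ffun k.-tuple G -> C^o} (@translation_invariant k)
  (@translation_invariant_submod k).

(* [box k] is P_(k,+).  The k arguments are the spins on the shaded boundary  *)
(* intervals in clockwise order from the marked (unshaded) interval.          *)
Record box k := MkBox {
  box_fun :> {ffun k.-tuple G -> C^o};
  _ : box_fun \in @translation_invariant k }.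

HB.instance Definition _ k := [isSub for @box_fun k].
HB.instance Definition _ k := [Choice of box k by <:].
HB.instance Definition _ k := [SubChoice_isSubLmodule of box k by <:].

Lemma boxE k (f : box k) g t : f (translate g t) = f t.
Proof. exact: (translation_invariantP _ (valP f)). Qed.

(* A labelled tangle is drawn in a horizontal strip and cut into slices, read *)
(* from top to bottom.  The strings crossing a horizontal line are numbered   *)
(* 0, 1, ... from left to right, and interval i of the line lies to the left  *)
(* of string i; interval i is shaded iff i is odd.                            *)
(*  Cap i     : a local maximum, creating strings i and i+1 below it;         *)
(*  Cup i     : a local minimum, joining strings i and i+1 above it;          *)
(*  Box i k f : a rectangle labelled f with k points on top and k points on   *)
(*              the bottom, its marked left side facing interval i (i even).  *)
Inductive slice :=
  | Cap of nat
  | Cup of nat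
  | Box (i k : nat) of box k.

Definition order_G : C := #|G|%:R.
Definition modulus : C := sqrtC order_G.

(* Factor of the extremum of the strings i and i+1: its concave side is the   *)
(* interval i+1, shaded iff i is even.                                        *)
Definition extremum_factor (i : nat) : C :=
  if odd i then 4.-root order_G else (4.-root order_G)^-1.

Definition eval_label k (f : box k) (s : seq G) : C :=
  oapp (f : k.-tuple G -> C) 0 (insub s).

(* Sum over the spins of the state weights of the tangle w, when [c] (resp.   *)
(* [d]) lists from left to right the spins of the shaded intervals of the top *)
(* (resp. bottom) line.  Interval 2j+1 is entry j of the list.                *)
(*  - At an extremum with i even the shaded interval i+1 is created (and its  *)
(*    spin summed over) or ended; with i odd, i and i+2 are two intervals of  *)
(*    a single shaded region, which have to carry equal spins.                *)
(*  - The top of a k-box sees [uphalf k] shaded intervals, the last of which  *)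
(*    is its right side if k is odd; e lists the remaining k./2 shaded        *)
(*    intervals, met from right to left when going round the box clockwise.   *)
Fixpoint state_sum (w : seq slice) (c d : seq G) : C :=
  match w with
  | [::] => (c == d)%:R
  | Cap i :: w' => let j := i./2 in
      extremum_factor i *
      if odd i then state_sum w' (take j.+1 c ++ drop j c) d
      else \sum_(g : G) state_sum w' (take j c ++ g :: drop j c) d
  | Cup i :: w' => let j := i./2 in
      extremum_factor i *
      (if odd i then (onth c j == onth c j.+1)%:R else 1) *
      state_sum w' (take j c ++ drop j.+1 c) d
  | Box i k f :: w' => let j := i./2 in
      \sum_(e : k./2.-tuple G)
        eval_label f (take (uphalf k) (drop j c) ++ rev e) *
        state_sum w' (take j c ++ e ++ drop (j + k./2) c) d
  end.

Lemma eval_label_map k (f : box k) g s :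
  eval_label f (map (mulg g) s) = eval_label f s.
Proof.
rewrite /eval_label; case: (boolP (size s == k)) => [sk|skN].
  have -> : s = Tuple sk by [].
  have -> : map (mulg g) (Tuple sk) = translate g (Tuple sk) by [].
  by rewrite !valK /= boxE.
by rewrite !insubF //= ?size_map; apply/negbTE.
Qed.

#[local] Arguments onth : simpl never.

Lemma onth_map (S T : Type) (f : S -> T) s n :
  onth (map f s) n = omap f (onth s n).
Proof. by elim: s n => [|x s IHs] [|n] //=; apply: IHs. Qed.

Lemma state_sum_map w g c d :
  state_sum w (map (mulg g) c) (map (mulg g) d) = state_sum w c d.
Proof.
elim: w c => [|[i|i|i k f] w IH] c /=.
- by rewrite (inj_eq (inj_map (mulgI g))).
- congr (_ * _); case: ifP => _.
    by rewrite -map_take -map_drop -map_cat IH.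
  rewrite (reindex_inj (mulgI g)) /=; apply: eq_bigr => h _.
  by rewrite -map_take -map_drop -map_cons -map_cat IH.
- rewrite -map_take -map_drop -map_cat IH; congr (_ * _ * _).
  case: ifP => // _; rewrite !onth_map; congr (nat_of_bool _)%:R.
  case: (onth c i./2) (onth c i./2.+1) => [x|] [y|] //=.
  by apply/eqP/eqP => [[/mulgI->]|[->]].
- rewrite (reindex (translate g)) /=; last exact/onW_bij/translate_bij.
  apply: eq_bigr => e _; rewrite -map_rev -!map_take -!map_drop -!map_take.
  by rewrite -!map_cat eval_label_map IH.
Qed.

(* The clockwise arguments of a box drawn with k top and k bottom points,     *)
(* split into the shaded intervals of its top and bottom sides, both listed   *)
(* from left to right; the right side belongs to both if it is shaded.        *)
Definition top_spins k (s : seq G) : seq G := take (uphalf k) s.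
Definition bottom_spins k (s : seq G) : seq G :=
  rev (drop (uphalf k) s) ++ drop k./2 (top_spins k s).

Definition tangle_fun k (w : seq slice) : {ffun k.-tuple G -> C^o} :=
  [ffun t : k.-tuple G => state_sum w (top_spins k t) (bottom_spins k t)].

Fact tangle_subproof k w : tangle_fun k w \in @translation_invariant k.
Proof.
apply/translation_invariantP => g t; rewrite !ffunE /bottom_spins /top_spins /=.
by rewrite -map_take -!map_drop -map_rev -map_cat state_sum_map.
Qed.

Definition tangle k (w : seq slice) : box k := MkBox (tangle_subproof k w).

(* Reflection in a horizontal axis: the marked side stays on the left and the *)
(* clockwise order of the arguments is reversed.                              *)
Definition adjoint_fun k (f : box k) : {ffun k.-tuple G -> C^o} :=
  [ffun t : k.-tuple G => (f (rev_tuple t))^*].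

Fact adjoint_subproof k (f : box k) : adjoint_fun f \in @translation_invariant k.
Proof.
apply/translation_invariantP => g t; rewrite !ffunE.
have -> : rev_tuple (translate g t) = translate g (rev_tuple t).
  by apply/val_inj; rewrite /= map_rev.
by rewrite boxE.
Qed.

Definition adjoint k (f : box k) : box k := MkBox (adjoint_subproof f).

Section GradedAlgebra.

Variable k : nat.

(* A box of A^k_m, marked at its top-left corner, is redrawn in strip form    *)
(* with top points T_1 .. T_2m R_1 .. R_k and bottom points                   *)
(* L_1 .. L_k B_1 .. B_2m, from left to right.                                *)

Notation width m := (m.*2 + k)%N.

(* Strip form of the product: the bottom points L_1 .. L_k of b lie straight  *)
(* above the top points R_1 .. R_k of a.                                      *)
Definition concat_tangle i j (a : box (width i)) (b : box (width j)) :
    seq slice :=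
  [:: Box i.*2 b; Box 0 a].

(* Reflecting left and right moves the mark to the top-right corner.  The     *)
(* adjoint, drawn with that mark on its left side, has top points             *)
(* R_1 .. R_k B_2m .. B_1 and bottom points T_2m .. T_1 L_1 .. L_k.           *)
Definition dagger_tangle m (a : box (width m)) : seq slice :=
  [seq Cap (width m + j) | j <- iota 0 m.*2] ++
  [:: Box m.*2 (adjoint a)] ++
  rev [seq Cup j | j <- iota 0 m.*2].

Definition noncrossing_pairing n (T : {ffun 'I_n -> 'I_n}) : bool :=
  [forall i, (T (T i) == i) && (T i != i)] &&
  [forall i : 'I_n, forall j : 'I_n, ~~ [&& i < j, j < T i & T i < T j]]%N.

(* The arcs of T are drawn by creating the arc starting at p as a cap at p,   *)
(* for increasing p: the arcs starting later end up nested in or to the right *)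
(* of the existing ones.                                                      *)
Definition openings n (T : {ffun 'I_n -> 'I_n}) : seq nat :=
  [seq val p | p : 'I_n <- enum 'I_n & (p < T p)%N].

(* The points R_i and L_i are joined by strings passing to the right of the   *)
(* strip form, so that the unbounded region is unshaded.                      *)
Definition closure_tangle m (a : box (width m))
    (T : {ffun 'I_(m.*2) -> 'I_(m.*2)}) : seq slice :=
  [seq Cap i | i <- iota 0 k] ++
  [seq Cap p | p <- openings T] ++
  [:: Box 0 a] ++
  rev [seq Cup (k + p) | p <- openings T] ++
  rev [seq Cup i | i <- iota 0 k].

Definition closure_value m (a : box (width m)) T : C :=
  state_sum (closure_tangle a T) [::] [::].

(* The direct sum of the A^k_m, m >= 0.                                       *)
Record graded := MkGraded {
  component :> forall m, box (width m);
  _ : exists M, forall m, (M <= m)%N -> component m = 0 }.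

HB.instance Definition _ := gen_eqMixin graded.
HB.instance Definition _ := gen_choiceMixin graded.

Lemma gradedP (a b : graded) : (forall m, a m = b m) -> a = b.
Proof.
case: a b => [a a0] [b b0] /= ab.
have {}ab : a = b by apply: functional_extensionality_dep.
by subst b; congr MkGraded; apply: Prop_irrelevance.
Qed.

Lemma graded_fin (a : graded) : exists M, forall m, (M <= m)%N -> a m = 0.
Proof. by case: a. Qed.

Fact graded0_fin :
  exists M, forall m, (M <= m)%N -> (fun m => 0 : box (width m)) m = 0.
Proof. by exists 0%N. Qed.

Fact gradedN_fin (a : graded) :
  exists M, forall m, (M <= m)%N -> (fun m => - a m) m = 0.
Proof. by have [M aM] := graded_fin a; exists M => m /aM->; rewrite oppr0. Qed.

Fact gradedD_fin (a b : graded) :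
  exists M, forall m, (M <= m)%N -> (fun m => a m + b m) m = 0.
Proof.
have [M aM] := graded_fin a; have [N bN] := graded_fin b.
exists (maxn M N) => m; rewrite geq_max => /andP[/aM-> /bN->].
by rewrite addr0.
Qed.

Fact gradedZ_fin (x : C) (a : graded) :
  exists M, forall m, (M <= m)%N -> (fun m => x *: a m) m = 0.
Proof. by have [M aM] := graded_fin a; exists M => m /aM->; rewrite scaler0. Qed.

Definition graded0 := MkGraded graded0_fin.
Definition gradedN a := MkGraded (gradedN_fin a).
Definition gradedD a b := MkGraded (gradedD_fin a b).
Definition gradedZ x a := MkGraded (gradedZ_fin x a).

Fact gradedDA : associative gradedD.
Proof. by move=> a b c; apply: gradedP => m /=; rewrite addrA. Qed.
Fact gradedDC : commutative gradedD.
Proof. by move=> a b; apply: gradedP => m /=; rewrite addrC. Qed.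
Fact graded0D : left_id graded0 gradedD.
Proof. by move=> a; apply: gradedP => m /=; rewrite add0r. Qed.
Fact gradedND : left_inverse graded0 gradedN gradedD.
Proof. by move=> a; apply: gradedP => m /=; rewrite addNr. Qed.

HB.instance Definition _ :=
  GRing.isZmodule.Build graded gradedDA gradedDC graded0D gradedND.

Fact gradedZA x y (a : graded) : gradedZ x (gradedZ y a) = gradedZ (x * y) a.
Proof. by apply: gradedP => m /=; rewrite scalerA. Qed.
Fact graded1Z : left_id 1 gradedZ.
Proof. by move=> a; apply: gradedP => m /=; rewrite scale1r. Qed.
Fact gradedZD : right_distributive gradedZ +%R.
Proof. by move=> x a b; apply: gradedP => m /=; rewrite scalerDr. Qed.
Fact gradedDZ (a : graded) : {morph gradedZ^~ a : x y / x + y}.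
Proof. by move=> x y; apply: gradedP => m /=; rewrite scalerDl. Qed.

HB.instance Definition _ :=
  GRing.Zmodule_isLmodule.Build C graded gradedZA graded1Z gradedZD gradedDZ.

Lemma componentD (a b : graded) m : (a + b) m = a m + b m. Proof. by []. Qed.
Lemma component0 m : (0 : graded) m = 0. Proof. by []. Qed.
Lemma componentZ x (a : graded) m : (x *: a) m = x *: a m. Proof. by []. Qed.

Definition concat m i j (a : box (width i)) (b : box (width j)) :
    box (width m) :=
  tangle (width m) (concat_tangle a b).

Lemma eval_labelP n (x : C) (f g : box n) s :
  eval_label (x *: f + g) s = x * eval_label f s + eval_label g s.
Proof.
rewrite /eval_label; case: insubP => [t _ _|_] /=; first by rewrite !ffunE.
by rewrite mulr0 addr0.
Qed.

Lemma concat_linearl m i j (b : box (width j)) :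
  linear (fun a : box (width i) => concat m a b).
Proof.
move=> x a a'; apply/val_inj/ffunP => t; rewrite !ffunE /=.
rewrite [X in _ = X + _]mulr_sumr -big_split; apply: eq_bigr => e _ /=.
rewrite mulrCA -mulrDr; congr (_ * _).
rewrite mulr_sumr -big_split; apply: eq_bigr => e' _ /=.
by rewrite eval_labelP; ring.
Qed.

Lemma concat_linearr m i j (a : box (width i)) :
  linear (fun b : box (width j) => concat m a b).
Proof.
move=> x b b'; apply/val_inj/ffunP => t; rewrite !ffunE /=.
rewrite [X in _ = X + _]mulr_sumr -big_split; apply: eq_bigr => e _ /=.
by rewrite eval_labelP; ring.
Qed.

HB.instance Definition _ m i j (a : box (width i)) :=
  GRing.isLinear.Build C (box (width j)) (box (width m)) _ (concat m a)
    (@concat_linearr m i j a).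

Definition concatr m i j b := fun a => @concat m i j a b.
HB.instance Definition _ m i j (b : box (width j)) :=
  GRing.isLinear.Build C (box (width i)) (box (width m)) _ (concatr m b)
    (@concat_linearl m i j b).

Definition mul_component (a b : graded) m : box (width m) :=
  \sum_(i < m.+1) concat m (a i) (b (m - i)%N).

Fact gradedM_fin a b : exists M, forall m, (M <= m)%N -> mul_component a b m = 0.
Proof.
have [M aM] := graded_fin a; have [N bN] := graded_fin b.
exists (M + N)%N => m leMNm; apply: big1 => i _.
have [leMi|ltiM] := leqP M i; first by rewrite aM // [LHS](linear0 (concatr m _)).
rewrite bN; first exact: linear0.
by rewrite leq_subRL; lia.
Qed.

Definition gradedM a b : graded := MkGraded (gradedM_fin a b).

Fact homogeneous_fin m0 w : exists M, forall m, (M <= m)%N ->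
  (fun m => if m == m0 then tangle (width m) w else 0) m = 0.
Proof. by exists m0.+1 => m ltm; rewrite gtn_eqF. Qed.

Definition homogeneous m0 w : graded := MkGraded (homogeneous_fin m0 w).

Definition graded1 : graded := homogeneous 0 [::].

(* The operator on functions of the spins of a horizontal line defined by a   *)
(* box with p shaded intervals on its left.                                   *)
Definition act p n (f : box n) (K : seq G -> C) (c : seq G) : C :=
  \sum_(e : n./2.-tuple G)
    eval_label f (take (uphalf n) (drop p c) ++ rev e) *
    K (take p c ++ e ++ drop (p + n./2) c).

Lemma eval_label_tuple n (f : box n) (t : n.-tuple G) : eval_label f t = f t.
Proof. by rewrite /eval_label valK. Qed.

Lemma spinsK n x (e : n./2.-tuple G) : size x = uphalf n ->
  top_spins n (x ++ rev e) = x /\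
  bottom_spins n (x ++ rev e) = e ++ drop n./2 x.
Proof.
move=> sx; rewrite /bottom_spins /top_spins.
by rewrite take_size_cat // drop_size_cat // revK.
Qed.

Lemma eval_tangle n w x (e : n./2.-tuple G) : size x = uphalf n ->
  eval_label (tangle n w) (x ++ rev e) = state_sum w x (e ++ drop n./2 x).
Proof.
move=> sx; have sn : size (x ++ rev e) == n.
  by rewrite size_cat size_rev sx size_tuple; lia.
rewrite (_ : x ++ rev e = Tuple sn) // eval_label_tuple ffunE /=.
by have [-> ->] := spinsK e sx.
Qed.

Lemma eq_act p n (f : box n) K1 K2 c :
  (forall e : n./2.-tuple G, K1 (take p c ++ e ++ drop (p + n./2) c) =
             K2 (take p c ++ e ++ drop (p + n./2) c)) ->
  act p f K1 c = act p f K2 c.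
Proof. by move=> K12; apply: eq_bigr => e _; rewrite K12. Qed.


Lemma cat_split (c : seq G) n : (n <= size c)%N ->
  exists c1 c2, c = c1 ++ c2 /\ size c1 = n.
Proof.
move=> nc; exists (take n c), (drop n c); rewrite cat_take_drop.
by rewrite size_takel.
Qed.

Lemma half_width m : (width m)./2 = (m + k./2)%N. Proof. lia. Qed.
Lemma uphalf_width m : uphalf (width m) = (m + uphalf k)%N. Proof. lia. Qed.

Lemma concat_state_sum i j (a : box (width i)) (b : box (width j)) c d :
  state_sum (concat_tangle a b) c d =
  act i b (act 0 a (fun z => (z == d)%:R)) c.
Proof. by rewrite /= doubleK. Qed.

Lemma act_concat p i j (a : box (width i)) (b : box (width j)) K c :
  (p + (i + j + uphalf k) <= size c)%N ->
  act p (concat (i + j) a b) K c = act (p + i) b (act p a K) c.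
Proof.
have leh : (k./2 <= uphalf k)%N by lia.
move=> szc; have [c1 [c' [ec sc1]]] : exists c1 c2, c = c1 ++ c2 /\ size c1 = p.
  by apply: cat_split; lia.
move: szc; rewrite {c}ec !size_cat sc1 leq_add2l => szc.
have [ca [c {c' szc}[-> sca szc]]] : exists ca c2, [/\ c' = ca ++ c2,
    size ca = i & (j + uphalf k <= size c2)%N].
  have [|ca [c2 [e2 s2]]] := @cat_split c' i; first by lia.
  by exists ca, c2; split=> //; move: szc; rewrite e2 size_cat s2; lia.
have [cb [c' {c szc}[-> scb szc]]] : exists cb c2, [/\ c = cb ++ c2,
    size cb = (j + k./2)%N & (uphalf k - k./2 <= size c2)%N].
  have [|cb [c2 [e2 s2]]] := @cat_split c (j + k./2); first by lia.
  by exists cb, c2; split=> //; move: szc; rewrite e2 size_cat s2; lia.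
have [cd [c3 [{c' szc}-> scd]]] := cat_split szc.
rewrite /act.
pose x := ca ++ cb ++ cd.
have sx : size x = uphalf (width (i + j)).
  by rewrite uphalf_width !size_cat sca scb scd; lia.
have -> : take (uphalf (width (i + j))) (drop p (c1 ++ ca ++ cb ++ cd ++ c3)) = x.
  rewrite -sc1 drop_size_cat // (_ : ca ++ _ = x ++ c3) ?take_size_cat //.
  by rewrite /x !catA.
under eq_bigr do rewrite eval_tangle // concat_state_sum /act mulr_suml.
rewrite exchange_big /=; apply: eq_bigr => e1 _.
have se1 : size e1 = (j + k./2)%N by rewrite size_tuple half_width.
under eq_bigr do rewrite -mulrA; rewrite -mulr_sumr; congr (_ * _).
  congr (eval_label _ (_ ++ _)).
  have -> : drop i x = cb ++ cd by rewrite -sca drop_size_cat.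
  have -> : drop (p + i) (c1 ++ ca ++ cb ++ cd ++ c3) = (cb ++ cd) ++ c3.
    by rewrite addnC -drop_drop -sc1 drop_size_cat // -sca drop_size_cat // catA.
  have scbd : size (cb ++ cd) = uphalf (width j).
    by rewrite size_cat scb scd uphalf_width; lia.
  by rewrite take_oversize ?scbd // take_size_cat.
under [LHS]eq_bigr do rewrite mulr_suml; rewrite exchange_big /=.
apply: eq_bigr => e2 _.
have se2 : size e2 = (i + k./2)%N by rewrite size_tuple half_width.
have [wa [wb [ew swa]]] : exists wa wb, ca ++ e1 = wa ++ wb /\ size wa = (i + k./2)%N.
  by apply: cat_split; rewrite size_cat sca se1; lia.
have swb : size wb = j.
  by have := congr1 size ew; rewrite !size_cat sca se1 swa; lia.
have dropx : drop (i + (width j)./2) x = cd.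
  rewrite addnC -drop_drop -sca drop_size_cat // half_width -scb.
  by rewrite drop_size_cat.
have -> : take i x ++ e1 ++ drop (i + (width j)./2) x = wa ++ wb ++ cd.
  by rewrite dropx -sca take_size_cat // catA ew catA.
have dropc : drop (p + i + (width j)./2) (c1 ++ ca ++ cb ++ cd ++ c3) = cd ++ c3.
  rewrite (addnC (p + i)%N) -drop_drop (addnC p) -drop_drop.
  rewrite -sc1 drop_size_cat // -sca drop_size_cat // half_width -scb.
  by rewrite drop_size_cat.
have -> : take (p + i) (c1 ++ ca ++ cb ++ cd ++ c3) ++
    e1 ++ drop (p + i + (width j)./2) (c1 ++ ca ++ cb ++ cd ++ c3) =
    c1 ++ wa ++ wb ++ cd ++ c3.
  rewrite dropc [c1 ++ ca ++ _]catA take_size_cat ?size_cat ?sc1 ?sca //.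
  by rewrite -!catA (catA ca) ew -catA.
have dropx' : drop (width (i + j))./2 x = cd.
  by rewrite /x catA drop_size_cat // size_cat sca scb half_width; lia.
have dropc' : drop (p + (width (i + j))./2) (c1 ++ ca ++ cb ++ cd ++ c3) = cd ++ c3.
  rewrite addnC -drop_drop -sc1 (drop_size_cat _ (erefl (size c1))) (catA ca) drop_size_cat //.
  by rewrite size_cat sca scb half_width; lia.
have dropw : drop (p + (width i)./2) (c1 ++ wa ++ wb ++ cd ++ c3) = wb ++ cd ++ c3.
  by rewrite addnC -drop_drop -sc1 drop_size_cat // half_width -swa drop_size_cat.
have dropw0 : drop (0 + (width i)./2) (wa ++ wb ++ cd) = wb ++ cd.
  by rewrite half_width -swa drop_size_cat.
rewrite dropx' dropc' dropw dropw0 take0 drop0 cat0s.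
have -> : take p (c1 ++ wa ++ wb ++ cd ++ c3) = c1 by rewrite -sc1 take_size_cat.
have -> : take p (c1 ++ ca ++ cb ++ cd ++ c3) = c1 by rewrite -sc1 take_size_cat.
have -> : drop p (c1 ++ wa ++ wb ++ cd ++ c3) = (wa ++ wb ++ cd) ++ c3.
  by rewrite -sc1 drop_size_cat // -!catA.
have -> : take (uphalf (width i)) ((wa ++ wb ++ cd) ++ c3) =
    take (uphalf (width i)) (wa ++ wb ++ cd).
  by rewrite takel_cat // !size_cat swa swb scd uphalf_width; lia.
have se0 : size (e2 ++ wb) == (width (i + j))./2.
  by rewrite size_cat se2 swb half_width; apply/eqP; lia.
rewrite (bigD1 (Tuple se0)) //= big1 ?addr0 => [|e neq_e].
  by rewrite -!catA eqxx mulr1.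
rewrite (catA e2) eqseq_cat; last by rewrite (eqP se0) size_tuple.
rewrite (_ : e2 ++ wb == e = false) ?mulr0 ?mul0r //.
apply/negbTE; apply: contraNN neq_e => /eqP ew0.
by apply/eqP/val_inj; rewrite /= ew0.
Qed.

Lemma concatE m i j (a : box (width i)) (b : box (width j)) t :
  concat m a b t =
  act i b (act 0 a (fun z => (z == bottom_spins (width m) t)%:R))
    (top_spins (width m) t).
Proof. by rewrite ffunE concat_state_sum. Qed.

Lemma size_top_spins m (t : (width m).-tuple G) :
  size (top_spins (width m) t) = (m + uphalf k)%N.
Proof. rewrite size_takel ?uphalf_width // size_tuple; lia. Qed.

Lemma concatA m i j l p q (a : box (width i)) (b : box (width j))
    (c : box (width l)) : p = (i + j)%N -> q = (j + l)%N -> m = (p + l)%N ->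
  concat m a (concat q b c) = concat m (concat p a b) c.
Proof.
move=> -> -> ->; apply/val_inj/ffunP => t.
rewrite [LHS]concatE [RHS]concatE act_concat ?size_top_spins; last by lia.
apply: eq_act => e; rewrite act_concat ?add0n //.
rewrite !size_cat size_take size_drop size_tuple size_top_spins half_width.
by case: ifP; lia.
Qed.

Lemma act_one p K c : (p + uphalf k <= size c)%N ->
  act p (tangle (width 0) [::]) K c = K c.
Proof.
have leh : (k./2 <= uphalf k)%N by lia.
move=> szc; have [c1 [c' [ec sc1]]] : exists c1 c2, c = c1 ++ c2 /\ size c1 = p.
  by apply: cat_split; lia.
move: szc; rewrite {c}ec size_cat sc1 leq_add2l => szc.
have [x [c3 [ec' sx]]] := cat_split szc; move: ec' szc => -> _.
have [e [y [ex se]]] : exists e y, x = e ++ y /\ size e = k./2.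
  by apply: cat_split; lia.
have se' : size e == (width 0)./2 by apply/eqP; rewrite se half_width.
rewrite /act -{1}sc1 drop_size_cat // take_size_cat; last by rewrite uphalf_width.
have takec : take p (c1 ++ x ++ c3) = c1 by rewrite -sc1 take_size_cat.
have dropc : drop (p + (width 0)./2) (c1 ++ x ++ c3) = y ++ c3.
  rewrite addnC -drop_drop -sc1 (drop_size_cat _ (erefl (size c1))) ex -catA.
  by rewrite half_width add0n -se drop_size_cat.
have dropx : drop (width 0)./2 x = y.
  by rewrite half_width add0n -se ex drop_size_cat.
rewrite takec dropc.
under eq_bigr do rewrite eval_tangle ?uphalf_width // dropx.
rewrite (bigD1 (Tuple se')) //= big1 ?addr0 => [|e' neq_e].
  by rewrite ex eqxx mul1r -catA.
rewrite ex eqseq_cat; last by rewrite (eqP se') size_tuple.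
rewrite (_ : e == e' = false) ?mul0r //.
by apply/negbTE; apply: contraNN neq_e => /eqP ee; apply/eqP/val_inj; rewrite /= ee.
Qed.

Lemma act_self m (a : box (width m)) (t : (width m).-tuple G) :
  act 0 a (fun z => (z == bottom_spins (width m) t)%:R) (top_spins (width m) t) =
  a t.
Proof.
have se : size (rev (drop (uphalf (width m)) t)) == (width m)./2.
  by rewrite size_rev size_drop size_tuple; apply/eqP; lia.
rewrite /act take0 drop0 add0n take_oversize; last first.
  by rewrite size_top_spins uphalf_width.
rewrite (bigD1 (Tuple se)) //= big1 ?addr0 => [|e neq_e].
  by rewrite eqxx mulr1 revK cat_take_drop eval_label_tuple.
rewrite eqseq_cat; last by rewrite (eqP se) size_tuple.
rewrite (_ : val e == _ = false) ?mulr0 //.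
by apply/negbTE; apply: contraNN neq_e => /eqP ee; apply/eqP/val_inj.
Qed.

Lemma concat1l m (a : box (width m)) : concat m (tangle (width 0) [::]) a = a.
Proof.
apply/val_inj/ffunP => t; rewrite [LHS]concatE -[RHS]act_self.
apply: eq_act => e; rewrite act_one //.
rewrite !size_cat size_take size_drop size_tuple size_top_spins half_width.
by case: ifP; lia.
Qed.

Lemma concat1r m (a : box (width m)) : concat m a (tangle (width 0) [::]) = a.
Proof.
apply/val_inj/ffunP => t; rewrite [LHS]concatE act_one ?size_top_spins //.
exact: act_self.
Qed.

Lemma sum_triangle (V : nmodType) (F : nat -> nat -> V) m :
  \sum_(i < m.+1) \sum_(j < (m - i).+1) F i j =
  \sum_(p < m.+1) \sum_(i < p.+1) F i (p - i)%N.
Proof.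
rewrite -(big_mkord xpredT (fun p => \sum_(i < p.+1) F i (p - i)%N)).
have -> : \sum_(0 <= p < m.+1) \sum_(i < p.+1) F i (p - i)%N =
    \sum_(0 <= p < m.+1) \sum_(0 <= i < m.+1 | (i < p.+1)%N) F i (p - i)%N.
  apply: eq_big_nat => p /andP[_ ltpm].
  by rewrite -(big_mkord xpredT (fun i => F i (p - i)%N)) (big_nat_widen _ _ m.+1).
rewrite (exchange_big_dep_nat xpredT) //= big_mkord; apply: eq_bigr => i _.
rewrite -(big_nat_widenl i 0 m.+1 xpredT (fun p => F i (p - i)%N)) //.
rewrite -[X in index_iota X _]add0n big_addn big_mkord subSn; last first.
  by rewrite -ltnS.
by apply: eq_bigr => j _; rewrite addnK.
Qed.

Lemma gradedME (a b : graded) m :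
  gradedM a b m = \sum_(i < m.+1) concat m (a i) (b (m - i)%N).
Proof. by []. Qed.

Fact gradedMA : associative gradedM.
Proof.
move=> a b c; apply: gradedP => m; rewrite !gradedME.
under eq_bigr do rewrite gradedME linear_sum /=.
rewrite (sum_triangle (fun i j =>
  concat m (a i) (concat (m - i) (b j) (c (m - i - j)%N)))).
apply: eq_bigr => p _; rewrite gradedME.
rewrite [RHS](linear_sum (concatr m (c (m - p)%N))) /=; apply: eq_bigr => i _.
have lti := ltn_ord i; have ltp := ltn_ord p.
have -> : (m - i - (p - i) = m - p)%N by lia.
by rewrite (concatA (p := p)) //; lia.
Qed.

Fact graded1M : left_id graded1 gradedM.
Proof.
move=> a; apply: gradedP => m; rewrite gradedME big_ord_recl /= big1 => [|i _].
  by rewrite addr0 subn0 concat1l.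
exact: (linear0 (concatr m _)).
Qed.

Fact gradedM1 : right_id graded1 gradedM.
Proof.
move=> a; apply: gradedP => m; rewrite gradedME big_ord_recr /= big1 => [|i _].
  by rewrite add0r subnn /= concat1r.
by rewrite -(subnSK (ltn_ord i)) /= linear0.
Qed.

Fact gradedMDl : left_distributive gradedM +%R.
Proof.
move=> a b c; apply: gradedP => m; rewrite gradedME componentD !gradedME.
rewrite -big_split; apply: eq_bigr => i _ /=.
exact: (linearD (concatr m _)).
Qed.

Fact gradedMDr : right_distributive gradedM +%R.
Proof.
move=> a b c; apply: gradedP => m; rewrite gradedME componentD !gradedME.
by rewrite -big_split; apply: eq_bigr => i _ /=; rewrite linearD.
Qed.

Fact graded1_neq0 : graded1 != 0.
Proof.
apply/eqP => /(congr1 (fun a : graded => a 0%N [tuple of nseq (width 0) 1%g])).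
rewrite /= !ffunE /bottom_spins /top_spins /=.
have e2 := odd_double_half (width 0); have eu := uphalf_half (width 0).
rewrite take_nseq; last by rewrite eu; lia.
rewrite !drop_nseq rev_nseq -nseqD.
rewrite (_ : (_ - _ + _)%N = uphalf (width 0)); last by rewrite eu; lia.
by move/eqP; rewrite eqxx oner_eq0.
Qed.

HB.instance Definition _ := GRing.Zmodule_isNzRing.Build graded
  gradedMA graded1M gradedM1 gradedMDl gradedMDr graded1_neq0.

Fact gradedZAl (x : C) (a b : graded) : x *: (a * b) = x *: a * b.
Proof.
apply: gradedP => m; rewrite componentZ !gradedME scaler_sumr.
by apply: eq_bigr => i _; rewrite [RHS](linearZZ (concatr m _)).
Qed.

HB.instance Definition _ := GRing.Lmodule_isLalgebra.Build C graded gradedZAl.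

Fact gradedZAr (x : C) (a b : graded) : x *: (a * b) = a * (x *: b).
Proof.
apply: gradedP => m; rewrite componentZ !gradedME scaler_sumr.
by apply: eq_bigr => i _; rewrite linearZZ.
Qed.

HB.instance Definition _ := GRing.Lalgebra_isAlgebra.Build C graded gradedZAr.

Lemma state_sum_box0 w i n v c d :
  state_sum (w ++ Box i (0 : box n) :: v) c d = 0.
Proof.
elim: w c => [|[j|j|j p f] w IH] c /=.
- by apply: big1 => e _; rewrite /eval_label; case: insub => [t|] /=;
    rewrite ?ffunE mul0r.
- by case: ifP => _; rewrite ?big1 ?IH ?mulr0.
- by rewrite IH mulr0.
- by apply: big1 => e _; rewrite IH mulr0.
Qed.

Lemma adjoint0 n : adjoint (0 : box n) = 0.
Proof. by apply/val_inj/ffunP => t; rewrite !ffunE conjC0. Qed.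

Fact dagger_fin (a : graded) : exists M, forall m, (M <= m)%N ->
  (fun m => tangle (width m) (dagger_tangle (a m))) m = 0.
Proof.
have [M aM] := graded_fin a; exists M => m /aM->.
apply/val_inj/ffunP => t; rewrite !ffunE /dagger_tangle adjoint0.
exact: state_sum_box0.
Qed.

Definition dagger (a : graded) : graded := MkGraded (dagger_fin a).

(* The sum over m has finite support. *)
Definition graded_trace (a : graded) : C :=
  modulus ^- k *
  \sum_(m \in [set: nat])
    \sum_(T : {ffun 'I_(m.*2) -> 'I_(m.*2)} | noncrossing_pairing T)
      closure_value (a m) T.

End GradedAlgebra.

(* Strip form: top points T_1 T_2 R_1 R_2 R_3, bottom points L_1 L_2 L_3 B_1  *)
(* B_2, the strings joining T_1-L_1, T_2-R_1, R_2-L_2, L_3-B_1 and R_3-B_2.   *)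
Definition Z_element : graded 3 := homogeneous 3 1 [:: Cup 1; Cap 2].

End GroupPlanarAlgebra.

Section Freeness.

Variables (K : nzRingType) (A : algType K).

Record unital_subalgebra := UnitalSubalgebra {
  subalgebra_set :> A -> Prop;
  subalgebra1 : subalgebra_set 1;
  subalgebraP : forall (x : K) a b,
    subalgebra_set a -> subalgebra_set b -> subalgebra_set (x *: a + b);
  subalgebraM : forall a b,
    subalgebra_set a -> subalgebra_set b -> subalgebra_set (a * b) }.

Definition generated_set (star : A -> A) (x : A) : set A :=
  [set a | forall B : unital_subalgebra,
     (forall b, B b -> B (star b)) -> B x -> B a].

Definition star_generated (star : A -> A) (x : A) : unital_subalgebra.
Proof.
exists (generated_set star x) => [B _ _|c a b aB bB B sB xB|a b aB bB B sB xB].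
- exact: subalgebra1.
- exact: subalgebraP (aB B sB xB) (bB B sB xB).
- exact: subalgebraM (aB B sB xB) (bB B sB xB).
Defined.

Definition free_family (phi : A -> K) (I : Type) (B : I -> unital_subalgebra) : Prop :=
  forall (q : nat) (i : 'I_q -> I) (a : 'I_q -> A),
    (1 <= q)%N ->
    (forall j, B (i j) (a j)) ->
    (forall j, phi (a j) = 0) ->
    (forall j j' : 'I_q, j' = j.+1 :> nat -> i j <> i j') ->
    phi (\prod_(j < q) a j) = 0.

Definition free_pair (phi : A -> K) (B1 B2 : unital_subalgebra) : Prop :=
  free_family phi (fun b : bool => if b then B1 else B2).

End Freeness.

Section DegreeZero.

Variables (C : numClosedFieldType) (G : finGroupType) (k : nat).

Definition degree0_set : set (graded C G k) :=
  [set a | forall m, (0 < m)%N -> a m = 0].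

(* P_(k,+) = A^k_0 as a subalgebra of the graded algebra. *)
Definition degree0 : unital_subalgebra (graded C G k).
Proof.
exists degree0_set => [m m_gt0|x a b a0 b0 m m_gt0|a b a0 b0 m m_gt0].
- by move: m_gt0; rewrite /= lt0n => /negPf->.
- by rewrite componentD componentZ a0 // b0 // scaler0 addr0.
rewrite gradedME big1 // => -[[|i] /= lti] _.
  by rewrite b0 ?subn0 // linear0.
by rewrite a0 //; exact: (linear0 (concatr m _)).
Defined.

End DegreeZero.

(* Main.v *)
Require Import Defs.
From HB Require Import structures.
From mathcomp Require Import all_boot all_order all_algebra all_fingroup.
From mathcomp Require Import complex boolp classical_sets fsbigop reals.
From mathcomp Require Import ring zify.
Set Implicit Arguments.
Unset Strict Implicit.
Unset Printing Implicit Defensive.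

Import Order.TTheory GRing.Theory Num.Theory.
Local Open Scope ring_scope.

(** Write n for the order of the group, and describe an element of A^3_m by the
    spins of the shaded intervals of its boundary: ts on the m top intervals, r
    and l between the two upper strings on the right and on the left, and bs on
    the m + 1 bottom intervals. An element x of P_(3,+) is then a family, indexed
    by its single bottom spin b, of matrices with entries x(l,r;b), and Z is the
    indicator function of t = l = r. Hence a word x_0 Z x_1 ... Z x_N is the
    function x_0(l,t_1;b_0) x_1(t_1,t_2;b_1) ... x_N(t_N,r;b_N) ([kernel_word]).

    Closing the word with a Temperley-Lieb diagram imposes equalities of spins:
    the shaded regions of the diagram identify top spins, those of its mirror
    image identify bottom spins, and the powers of n^(1/4) produced by the arcs
    of the diagram cancel those of its mirror image ([closure_alongE]). Follow the string
    that starts at the leftmost top point. It encloses a part of the word whose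
    value depends on the outside only through one spin; since labels are
    invariant under translation, which is the irreducibility of the planar
    algebra, this value is a constant. Summing over all diagrams gives, with phi
    the trace, the Schwinger-Dyson equation ([graded_trace_SD])

      phi(x Z W) = phi(x W) + n * sum over W = W1 Z W2 of phi(Z W1) phi(x W2),

    for x in P_(3,+) and W a word in Z and P_(3,+). It is the recursion satisfied
    by a free Poisson element, with free cumulants n^(k-1), that is free from
    P_(3,+).

    The equation alone implies freeness ([free_of_schwinger_dyson]). The trace
    of x_0 Z^k x_1 a_2 x_2 ... a_q x_q with q > 1, where x_1, ..., x_(q-1) and the
    polynomials a_i in Z are centered, vanishes by induction on the total degree
    in Z and the length: expanding the first Z yields products of two traces in
    each of which one factor is a shorter expression of the same shape
    ([power_alternating]).

    Finally the star-algebra generated by Z consists of polynomials in Z, because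
    every power of Z is self-adjoint: its kernel is a real function invariant
    under the reversal of the boundary ([dagger_power]). *)

(** * Freeness from the Schwinger-Dyson equation *)

Section FreenessCriterion.

Variables (K : comNzRingType) (A : algType K) (B : unital_subalgebra A).
Variables (phi : A -> K) (Z : A) (c : K).

Fixpoint word (x : A) (ys : seq A) : A :=
  if ys is y :: ys' then x * (Z * word y ys') else x.

(** The free difference quotient with respect to [Z]: the derivation that maps
    [Z] to the tensor 1 (x) 1 and kills [B], as a list of pure tensors. *)
Fixpoint splits (x : A) (ys : seq A) : seq (A * A) :=
  if ys is y :: ys' then
    (x, word y ys') :: [seq (x * (Z * p.1), p.2) | p <- splits y ys']
  else [::].

Fixpoint all_in (ys : seq A) : Prop :=
  if ys is y :: ys' then B y /\ all_in ys' else True.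

Definition schwinger_dyson : Prop :=
  forall x y ys, B x -> all_in (y :: ys) ->
    phi (x * (Z * word y ys)) =
    phi (x * word y ys) +
    c * \sum_(p <- splits y ys) phi (Z * p.1) * phi (x * p.2).

Hypotheses (phi_linear : scalar phi) (phi1 : phi 1 = 1).
Hypothesis phi_SD : schwinger_dyson.

Let phiD u v : phi (u + v) = phi u + phi v.
Proof. by have := phi_linear 1 u v; rewrite scale1r mul1r. Qed.
Let phi0 : phi 0 = 0.
Proof. by have := phi_linear (-1) 0 0; rewrite scaler0 addr0 mulN1r addNr. Qed.
Let phiZ k u : phi (k *: u) = k * phi u.
Proof. by have := phi_linear k u 0; rewrite phi0 !addr0. Qed.
Let phi_sum I (r : seq I) F : phi (\sum_(i <- r) F i) = \sum_(i <- r) phi (F i).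
Proof. exact: (big_morph phi phiD phi0). Qed.

(** The free difference quotient is a function of a formal expression, not of
    its value in [A]: different expressions of an element may have different
    quotients. Thus it is a relation, saying that [d] is the quotient of
    some linear combination of words with value [W]. As only bilinear functions
    of [d] matter, [d] is compared with that quotient through products of linear
    forms. *)
Definition derivative (W : A) (d : seq (A * A)) : Prop :=
  exists s : seq (K * (A * seq A)),
  [/\ forall t, t \in s -> all_in (t.2.1 :: t.2.2),
      W = \sum_(t <- s) t.1 *: word t.2.1 t.2.2 &
      forall f g : A -> K, scalar f -> scalar g ->
        \sum_(p <- d) f p.1 * g p.2 =
        \sum_(t <- s) t.1 * \sum_(p <- splits t.2.1 t.2.2) f p.1 * g p.2].

Lemma scalar_mull (f : A -> K) u : scalar f -> scalar (fun v => f (u * v)).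
Proof. by move=> fl k v w; rewrite mulrDr -scalerAr fl. Qed.

(** By linearity the Schwinger-Dyson equation passes from words to all
    expressions, whichever expression of [W] the quotient [d] comes from. *)
Lemma SD_derivative x W d : B x -> derivative W d ->
  phi (x * (Z * W)) =
  phi (x * W) + c * \sum_(p <- d) phi (Z * p.1) * phi (x * p.2).
Proof.
move=> Bx [s [Bs -> ed]].
rewrite (ed _ _ (scalar_mull Z phi_linear) (scalar_mull x phi_linear)).
rewrite !mulr_sumr !phi_sum -big_split !big_seq; apply: eq_bigr => t ts /=.
rewrite -!scalerAr !phiZ phi_SD //; last exact: Bs.
by rewrite mulrDr; congr (_ + _); rewrite mulrCA.
Qed.

Lemma derivative_base x : B x -> derivative x [::].
Proof.
move=> Bx; exists [:: (1, (x, [::]))]; split=> [t|//|f g fl gl].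
- by rewrite inE => /eqP->.
- by rewrite big_seq1 scale1r.
- by rewrite big_seq1 !big_nil mulr0.
Qed.

(** The Leibniz rule, for left multiplication by [Z] here and by an element of
    [B] in [derivative_mul]. *)
Lemma derivative_mulZ W d : derivative W d ->
  derivative (Z * W) ((1, W) :: [seq (Z * p.1, p.2) | p <- d]).
Proof.
move=> [s [Bs eW ed]].
exists [seq (t.1, (1, t.2.1 :: t.2.2)) | t <- s]; split=> [t|//|f g fl gl].
- by case/mapP => t' /Bs Bt' -> /=; split=> //; apply: subalgebra1.
- by rewrite big_map {1}eW mulr_sumr; apply: eq_bigr => t _; rewrite /= mul1r -scalerAr.
- rewrite big_cons !big_map /= (ed _ g (scalar_mull Z fl)) // eW.
  have g0 : g 0 = 0 by have := gl (-1) 0 0; rewrite scaler0 addr0 mulN1r addNr.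
  have gD u v : g (u + v) = g u + g v by have := gl 1 u v; rewrite scale1r mul1r.
  have -> : g (\sum_(t <- s) t.1 *: word t.2.1 t.2.2) =
      \sum_(t <- s) t.1 * g (word t.2.1 t.2.2).
    rewrite (big_morph g gD g0); apply: eq_bigr => t _.
    by have := gl t.1 (word t.2.1 t.2.2) 0; rewrite g0 !addr0.
  rewrite mulr_sumr -big_split; apply: eq_bigr => t _ /=.
  rewrite big_cons big_map mulrDr mulrCA; congr (_ + _ * _).
  by under [in RHS]eq_bigr do rewrite /= mul1r.
Qed.

Lemma derivative_mul x W d : B x -> derivative W d ->
  derivative (x * W) [seq (x * p.1, p.2) | p <- d].
Proof.
move=> Bx [s [Bs eW ed]].
exists [seq (t.1, (x * t.2.1, t.2.2)) | t <- s]; split=> [t|//|f g fl gl].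
- by case/mapP => t' /Bs [Bt' Bt] -> /=; split=> //; apply: subalgebraM.
- rewrite big_map eW mulr_sumr; apply: eq_bigr => -[k [y [|z ys]]] _ /=.
    by rewrite scalerAr.
  by rewrite -scalerAr -mulrA.
- rewrite !big_map /= (ed _ g (scalar_mull x fl)) //; apply: eq_bigr => t _ /=.
  congr (_ * _); case: t.2 => y [|z ys] /=; first by rewrite !big_nil.
  rewrite !big_cons !big_map; congr (_ + _).
  by apply: eq_bigr => p _; rewrite /= -[x * y * _]mulrA.
Qed.

Lemma derivative_add k W d W' d' : derivative W d -> derivative W' d' ->
  derivative (k *: W + W') ([seq (k *: p.1, p.2) | p <- d] ++ d').
Proof.
move=> [s [Bs -> ed]] [s' [Bs' -> ed']].
exists ([seq (k * t.1, t.2) | t <- s] ++ s'); split=> [t|//|f g fl gl].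
- by rewrite mem_cat => /orP[/mapP[t' /Bs ? -> //]|/Bs'].
- rewrite big_cat big_map scaler_sumr; congr (_ + _).
  by apply: eq_bigr => t _; rewrite scalerA.
- rewrite !big_cat !big_map ed' // /=; congr (_ + _).
  have fkl : scalar (fun v => f (k *: v)).
    by move=> a u v; rewrite scalerDr scalerA mulrC -scalerA fl.
  rewrite (ed _ g fkl) //.
  have f0 : f 0 = 0 by have := fl (-1) 0 0; rewrite scaler0 addr0 mulN1r addNr.
  have fk u : f (k *: u) = k * f u by have := fl k u 0; rewrite f0 !addr0.
  apply: eq_bigr => t _; rewrite -mulrA mulrCA; congr (_ * _).
  by rewrite mulr_sumr; apply: eq_bigr => p _; rewrite fk mulrA.
Qed.

Lemma derivative_eq W d d' :
  (forall f g : A -> K, scalar f -> scalar g ->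
     \sum_(p <- d) f p.1 * g p.2 = \sum_(p <- d') f p.1 * g p.2) ->
  derivative W d -> derivative W d'.
Proof. by move=> dd' [s [Bs eW ed]]; exists s; split=> // f g fl gl; rewrite -dd' ?ed. Qed.

Definition power_splits W k : seq (A * A) :=
  [seq (Z ^+ i, Z ^+ (k.-1 - i) * W) | i <- iota 0 k].

Lemma derivative_mulX W d k : derivative W d ->
  derivative (Z ^+ k * W) (power_splits W k ++ [seq (Z ^+ k * p.1, p.2) | p <- d]).
Proof.
move=> dW; elim: k => [|k IH].
  rewrite expr0 mul1r /=.
  by have -> : [seq (1 * p.1, p.2) | p <- d] = d by
    rewrite -[RHS]map_id; apply: eq_map => -[p q] /=; rewrite mul1r.
have {IH} := derivative_mulZ IH; rewrite mulrA -exprS.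
congr derivative; rewrite map_cat /power_splits /= -!map_comp subn0.
congr (_ :: _ ++ _).
  rewrite (iotaDl 1 0) -map_comp; apply/eq_in_map => i; rewrite mem_iota /= => ik.
  by rewrite add1n -exprS; congr (_, Z ^+ _ * _); lia.
by apply: eq_map => p /=; rewrite mulrA -exprS.
Qed.

Definition polynomial_in (N : nat) (a : A) : Prop :=
  exists r : nat -> K, a = \sum_(k < N) r k *: Z ^+ k.

(** The terms of the quotient that come from [a] lose one power of [Z]; the
    strict bound on [i + j] is what makes the later induction terminate. *)
Lemma derivative_polynomial N a W d : polynomial_in N a -> derivative W d ->
  exists2 L, derivative (a * W) (L ++ [seq (a * p.1, p.2) | p <- d]) &
    forall p, p \in L -> exists k i j,
      [/\ ((i + j).+1 < N)%N, p.1 = k *: Z ^+ i & p.2 = Z ^+ j * W].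
Proof.
move=> [r ->{a}] dW; elim: N => [|N [L dL memL]].
  exists [::] => //; rewrite big_ord0 mul0r /=.
  have dW0 := derivative_base (subalgebra1 B).
  have := derivative_add (-1) dW0 dW0; rewrite scaleN1r addNr /=.
  move/(_ : derivative 0 [::] -> _); apply; apply: derivative_eq => // f g fl gl.
  rewrite big_nil big_map big1 // => p _ /=; rewrite mul0r.
  have -> : f 0 = 0 by have := fl (-1) 0 0; rewrite scaler0 addr0 mulN1r addNr.
  by rewrite mul0r.
exists ([seq (r N *: p.1, p.2) | p <- power_splits W N] ++ L); last first.
  move=> p; rewrite mem_cat => /orP[|/memL[k [i [j [ij e1 e2]]]]]; last first.
    by exists k, i, j; split=> //; lia.
  case/mapP => _ /mapP[i + ->] ->; rewrite mem_iota /= => lti.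
  by exists (r N), i, (N.-1 - i)%N; split=> //; lia.
have := derivative_add (r N) (derivative_mulX N dW) dL.
rewrite big_ord_recr /= mulrDl [_ + _ * W]addrC -scalerAl.
apply: derivative_eq => f g fl gl.
rewrite map_cat -!catA !big_cat /=; congr (_ + _); rewrite addrCA; congr (_ + _).
rewrite !big_map -big_split; apply: eq_bigr => p _ /=.
rewrite [(_ + _) * p.1]mulrDl -scalerAl [_ + r N *: (_ * _)]addrC.
by rewrite -[X in f (X + _)]scale1r fl mul1r mulrDl.
Qed.

(** The simplest instance of freeness. Both sides satisfy the same recursion
    on [k]. *)
Lemma power_factor k x y : B x -> B y ->
  phi (x * (Z ^+ k * y)) = phi (Z ^+ k) * phi (x * y).
Proof.
elim/ltn_ind: k x y => -[|k] IH x y Bx By; first by rewrite !expr0 mul1r phi1 mul1r.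
have B1 : B 1 by apply: subalgebra1.
have expand u v : B u -> B v -> phi (u * (Z ^+ k.+1 * v)) =
    phi (u * (Z ^+ k * v)) +
    c * \sum_(i <- iota 0 k) phi (Z ^+ i.+1) * phi (u * (Z ^+ (k.-1 - i) * v)).
  move=> Bu Bv; rewrite exprS -mulrA.
  rewrite (SD_derivative Bu (derivative_mulX k (derivative_base Bv))).
  rewrite cats0 big_map; congr (_ + c * _).
  by apply: eq_bigr => i _; rewrite -exprS.
rewrite expand // IH //; have := expand 1 1 B1 B1.
rewrite !mul1r !mulr1 => ->; rewrite mulrDl -mulrA; congr (_ + c * _).
rewrite mulr_suml !big_seq; apply: eq_bigr => i; rewrite mem_iota => ik.
by rewrite IH ?mul1r ?mulr1 ?mulrA //; lia.
Qed.

Fixpoint alternating (x : A) (s : seq (nat * A * A)) : A :=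
  if s is (_, a, y) :: s' then x * (a * alternating y s') else x.

(** The last element of [B] is exempt from centering, so that products ending
    in a polynomial are covered by appending 1. *)
Fixpoint centered_tail (x : A) (s : seq (nat * A * A)) : Prop :=
  B x /\ if s is (N, a, y) :: s' then
    [/\ phi x = 0, polynomial_in N a, phi a = 0 & centered_tail y s'] else True.

Definition weight (s : seq (nat * A * A)) := (\sum_(t <- s) t.1.1.+1)%N.

Lemma centered_tail_B x s : centered_tail x s -> B x.
Proof. by case: s => [|[[N a] y] s] []. Qed.

(** A term of the quotient cuts the product inside one of the polynomials, and
    leaves on both sides alternating products of smaller weight with a power of
    [Z] at the cut. *)
Lemma derivative_alternating x s : centered_tail x s ->
  exists2 d, derivative (alternating x s) d &
    forall p, p \in d -> exists s1 N a y s2 k i j,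
      [/\ s = s1 ++ (N, a, y) :: s2, ((i + j).+1 < N)%N,
          p.1 = k *: (alternating x s1 * Z ^+ i) &
          p.2 = Z ^+ j * alternating y s2].
Proof.
elim: s x => [|[[N a] y] s IH] x /=.
  by case=> Bx _; exists [::] => //; apply: derivative_base.
case=> Bx [_ aN _ /IH[d dd memd]].
have [L dL memL] := derivative_polynomial aN dd.
exists [seq (x * p.1, p.2) | p <- L ++ [seq (a * p.1, p.2) | p <- d]].
  exact: derivative_mul.
move=> _ /mapP[p + ->] /=; rewrite mem_cat => /orP[|].
  move=> /memL[k [i [j [ij e1 e2]]]].
  by exists [::], N, a, y, s, k, i, j; rewrite e1 e2 /= -scalerAr; split.
move=> /mapP[{}p + ->] /= => /memd[s1 [N' [a' [y' [s2 [k [i [j [-> ij -> ->]]]]]]]]].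
exists ((N, a, y) :: s1), N', a', y', s2, k, i, j; split=> //=.
by rewrite -!scalerAr !mulrA.
Qed.

Lemma centered_tail_cat x s1 N a y s2 : centered_tail x (s1 ++ (N, a, y) :: s2) ->
  centered_tail x s1 /\ centered_tail y s2.
Proof.
by elim: s1 x => [|[[N' a'] y'] s1 IH] x /= => [[Bx [_ _ _ ?]]|[Bx [? ? ? /IH[]]]].
Qed.

Lemma centered_power k : polynomial_in k.+1 (Z ^+ k - (phi (Z ^+ k))%:A).
Proof.
exists (fun i => (i == k)%:R - (i == 0)%:R * phi (Z ^+ k)).
under eq_bigr do rewrite scalerBl; rewrite sumrB; congr (_ - _).
  rewrite (bigD1 ord_max) //= eqxx scale1r big1 ?addr0 // => i ik.
  by rewrite (negPf (_ : (i : nat) != k)) ?scale0r.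
rewrite (bigD1 ord0) //= mul1r big1 ?addr0 // => i i0.
by rewrite (negPf (_ : (i : nat) != 0%N)) ?mul0r ?scale0r.
Qed.

Lemma phi_centered_power k : phi (Z ^+ k - (phi (Z ^+ k))%:A) = 0.
Proof. by rewrite -scaleNr addrC phi_linear phi1 mulr1 addNr. Qed.

(** A power of [Z] at the right end is split into its centered part, which
    continues the alternating product, and a scalar. *)
Lemma alternating_rcons x s1 N a y s2 k :
  centered_tail x (s1 ++ (N, a, y) :: s2) ->
  [/\ alternating x s1 * Z ^+ k =
    alternating x (rcons s1 (k.+1, Z ^+ k - (phi (Z ^+ k))%:A, 1)) +
      phi (Z ^+ k) *: alternating x s1 &
    centered_tail x (rcons s1 (k.+1, Z ^+ k - (phi (Z ^+ k))%:A, 1))].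
Proof.
elim: s1 x => [|[[N' a'] y'] s1 IH] x /=.
  case=> Bx [x0 _ _ _]; split.
    by rewrite mulr1 mulrBr -scalerAr mulr1 subrK.
  split=> //; split=> //; first exact: centered_power.
    exact: phi_centered_power.
  by split=> //; apply: subalgebra1.
case=> Bx [x0 a'N a'0 /IH[e ?]]; split; last by split.
by rewrite -!mulrA e !mulrDr -!scalerAr.
Qed.

(** The heart of the freeness argument. The factor [Z ^+ k] and the element [x0]
    need not be centered, which allows the Schwinger-Dyson equation to be
    applied to the first [Z]. Each term of its expansion contains a factor of the
    same form and smaller weight: if the cut leaves something to its right, the
    right factor vanishes by induction; otherwise the left one does, after
    its trailing power of [Z] has been centered. *)
Lemma power_alternating n k x0 x s : B x0 -> centered_tail x s -> s <> [::] ->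
  (k + weight s <= n)%N -> phi (x0 * (Z ^+ k * alternating x s)) = 0.
Proof.
elim: n k x0 x s => [|n IH] k x0 x [|[[N a] y] s] // Bx0 cx _.
  by rewrite /weight big_cons /=; lia.
have [/= Bx [phix [r ea] phia cy]] := cx; have By := centered_tail_B cy.
case: k => [|k] le_n.
  rewrite expr0 mul1r /= [x0 * _]mulrA ea mulr_suml mulr_sumr phi_sum.
  case: s cx cy le_n => [|t s] cx cy le_n.
    transitivity (\sum_(k < N) phi (x0 * x * y) * phi (r k *: Z ^+ k)).
      apply: eq_bigr => k _; rewrite -scalerAl -scalerAr !phiZ.
      by rewrite power_factor //=; [ring | apply: subalgebraM].
    by rewrite -mulr_sumr -phi_sum -ea phia mulr0.
  apply: big1 => k _; rewrite -scalerAl -scalerAr phiZ IH ?mulr0 //.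
    exact: subalgebraM.
  by move: le_n; rewrite /weight !big_cons /=; have := ltn_ord k; lia.
have [d dd memd] := derivative_alternating cx.
rewrite exprS -mulrA (SD_derivative Bx0 (derivative_mulX k dd)) IH // add0r.
rewrite big1_seq ?mulr0 // => p /andP[_]; rewrite mem_cat => /orP[].
  case/mapP=> i; rewrite mem_iota => ik -> /=.
  by rewrite [X in _ * X](IH _ x0 x ((N, a, y) :: s)) ?mulr0 //; lia.
case/mapP => {}p /memd[s1 [N' [a' [y' [s2 [l [i [j [es ij -> ->]]]]]]]]] -> /=.
have := cx; rewrite es => /[dup] /centered_tail_cat[c1 c2] c12.
have w12 : weight ((N, a, y) :: s) = (weight s1 + N'.+1 + weight s2)%N.
  by rewrite es /weight big_cat big_cons /= addnA.
case: s2 => [|t s2] in es c2 c12 w12 *; last first.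
  by rewrite [X in _ * X]IH ?mulr0 //; lia.
have [-> c1'] := alternating_rcons i c12.
rewrite -!scalerAr phiZ mulrA -exprS mulrDr phiD.
(* The left factor starts with [Z]; it is put in the form of the statement by a leading 1. *)
have := @IH k.+1 1 x (rcons s1 (i.+1, Z ^+ i - (phi (Z ^+ i))%:A, 1)).
rewrite mul1r => -> //; first last.
- rewrite /weight -cats1 big_cat big_seq1 -/(weight s1) /=.
  move: w12 le_n; rewrite [weight [::]]/weight big_nil => -> le_n; lia.
- by case: (s1).
- exact: subalgebra1.
rewrite add0r -scalerAr phiZ.
suff -> : phi (Z ^+ k.+1 * alternating x s1) = 0 by rewrite !(mulr0, mul0r).
case: s1 => [|t s1] in es c12 c1 w12 c1' *.
  have := power_factor k.+1 (subalgebra1 B) Bx.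
  by rewrite !mul1r /= phix mulr0.
have := @IH k.+1 1 x (t :: s1); rewrite mul1r => -> //; last lia.
exact: subalgebra1.
Qed.

Lemma phi_alternating x0 N a y s : B x0 -> polynomial_in N a -> phi a = 0 ->
  centered_tail y s -> phi (x0 * (a * alternating y s)) = 0.
Proof.
move=> Bx0 [r ea] phia cy; rewrite ea mulr_suml mulr_sumr phi_sum.
case: s cy => [[By _] /=|t s cy].
  transitivity (\sum_(k < N) phi (x0 * y) * phi (r k *: Z ^+ k)).
    apply: eq_bigr => k _; rewrite -scalerAl -scalerAr !phiZ.
    by rewrite power_factor //; ring.
  by rewrite -mulr_sumr -phi_sum -ea phia mulr0.
apply: big1 => k _; rewrite -scalerAl -scalerAr phiZ.
by rewrite (@power_alternating (k + weight (t :: s))) ?mulr0.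
Qed.

Variable P : unital_subalgebra A.
Hypothesis P_polynomial : forall a, P a -> exists N, polynomial_in N a.

Fixpoint alternates (b : bool) (l : seq A) : Prop :=
  if l is a :: l' then [/\ (if b then P a else B a), phi a = 0 & alternates (~~ b) l']
  else True.

Lemma alternates_tail n x l : (size l <= n)%N -> B x -> (l <> [::] -> phi x = 0) ->
  alternates true l ->
  exists2 s, centered_tail x s & x * \prod_(a <- l) a = alternating x s.
Proof.
elim: n x l => [|n IH] x [|a l] // szl Bx x0.
- by exists [::] => //; rewrite big_nil mulr1.
- by exists [::] => //; rewrite big_nil mulr1.
case=> /P_polynomial[N aN] phia; case: l szl x0 => [|y l] szl x0.
  exists [:: (N, a, 1)]; last by rewrite big_seq1 /= mulr1.
  by do 2!split=> //; [apply: x0 | split=> //; apply: subalgebra1].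
case=> By phiy al.
have [|s cs es] := IH y l _ By (fun _ => phiy) al; first by move: szl => /=; lia.
exists ((N, a, y) :: s); first by do 2!split=> //; apply: x0.
by rewrite !big_cons /= es.
Qed.

(** A product that starts in [B] is brought to the form with a polynomial in
    second position; one that starts with a polynomial is preceded by 1. *)
Lemma phi_alternates b l : l <> [::] -> alternates b l -> phi (\prod_(a <- l) a) = 0.
Proof.
have start x0 l' : B x0 -> l' <> [::] -> alternates true l' ->
    phi (x0 * \prod_(a <- l') a) = 0.
  case: l' => [//|a l'] Bx0 _ [/P_polynomial[N aN] phia].
  have B1 := subalgebra1 B.
  case: l' => [|y l'].
    move=> _; have := @phi_alternating x0 N a 1 [::] Bx0 aN phia.
    by rewrite big_seq1 /= mulr1; apply.
  case=> By phiy al; have [s cs es] := alternates_tail (leqnn _) By (fun _ => phiy) al.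
  by rewrite !big_cons es; apply: (phi_alternating Bx0 aN).
case: b => [l0 al|].
  by have := start 1 l (subalgebra1 B) l0 al; rewrite mul1r.
case: l => [//|x l] _ [Bx phix]; case: l => [|a l] al; first by rewrite big_seq1.
by rewrite big_cons; apply: start.
Qed.

Theorem free_of_schwinger_dyson : free_pair phi P B.
Proof.
move=> q i a q_gt0 ia phia alt_i.
have i_q : (0 < q)%N by [].
pose l := [seq a j | j <- enum 'I_q].
have -> : \prod_(j < q) a j = \prod_(x <- l) x by rewrite big_map enumT.
have altl m (mq : (m < q)%N) : alternates (i (Ordinal mq))
    [seq a j | j <- drop m (enum 'I_q)].
  have [n] := ubnP (q - m); elim: n m mq => // n IH m mq lt_n.
  rewrite (drop_nth (Ordinal mq)) ?size_enum_ord //=.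
  have -> : nth (Ordinal mq) (enum 'I_q) m = Ordinal mq.
    by apply: val_inj; rewrite /= nth_enum_ord.
  split; [by have := ia (Ordinal mq); case: (i _) | exact: phia | ].
  have [m1q|] := ltnP m.+1 q; last first.
    by move=> qm; rewrite drop_oversize ?size_enum_ord.
  have -> : ~~ i (Ordinal mq) = i (Ordinal m1q).
    by have := @alt_i (Ordinal mq) (Ordinal m1q) erefl; case: (i _); case: (i _).
  by apply: IH; lia.
apply: (@phi_alternates (i (Ordinal i_q))).
  by move/(congr1 size); rewrite size_map size_enum_ord => q0; rewrite q0 in q_gt0.
by have := altl 0%N i_q; rewrite drop0.
Qed.

End FreenessCriterion.

(** * Noncrossing pairings and binary trees *)

(** A noncrossing pairing is encoded by the binary tree of its decomposition
    along the arc of the first point: [a] is what the arc encloses and [b] is what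
    follows it. *)
Inductive tree := Leaf | Node of tree & tree.

HB.instance Definition _ := gen_eqMixin tree.

Fixpoint nodes (t : tree) : nat :=
  if t is Node a b then (nodes a + nodes b).+1 else 0.

Fixpoint opening_points (p : nat) (t : tree) : seq nat :=
  if t is Node a b then
    p :: opening_points p.+1 a ++ opening_points (p + (nodes a).*2.+2) b
  else [::].

Lemma size_opening_points p t : size (opening_points p t) = nodes t.
Proof. by elim: t p => //= a IHa b IHb p; rewrite size_cat IHa IHb. Qed.

Lemma opening_points_shift p q t :
  opening_points (p + q) t = [seq (p + x)%N | x <- opening_points q t].
Proof.
elim: t q => //= a IHa b IHb q; rewrite map_cat -addnS IHa -IHb.
by rewrite addnA.
Qed.

Section Pairings.
Local Open Scope nat_scope.

(** Noncrossing pairings of the points [0, ..., n - 1] as functions on natural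
    numbers, so that cutting and gluing them requires no casts between ordinal
    types. *)
Definition pairing_on (n : nat) (f : nat -> nat) : Prop :=
  (forall p, p < n -> [/\ f p < n, f (f p) = p & f p <> p]) /\
  (forall p q, p < q -> q < f p -> f p < f q -> f q < n -> p < n -> q < n -> False).

Definition openings_on (n : nat) (f : nat -> nat) : seq nat :=
  [seq p <- iota 0 n | p < f p].

(** A noncrossing pairing is determined by the set of its opening points, as a
    closing point is matched with the last opening point that is still
    unmatched. At the smallest closing point where two pairings
    differ, the one with the longer arc would have its arc crossed. *)
Lemma pairing_on_inj n f g : pairing_on n f -> pairing_on n g ->
  (forall p, p < n -> (p < f p) = (p < g p)) -> forall p, p < n -> f p = g p.
Proof.
move=> fP gP fg.
have step f' g' q : pairing_on n f' -> pairing_on n g' ->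
    (forall p, p < n -> (p < f' p) = (p < g' p)) -> q < n -> f' q < q ->
    (forall r, r < q -> f' r < r -> f' r = g' r) -> f' q < g' q -> False.
  move=> [f'1 f'2] [g'1 g'2] fg' qn fq IH fgq.
  have [fqn ffq fqN] := f'1 q qn; have [gqn ggq gqN] := g'1 q qn.
  have gq : g' q < q by have := fg' q qn; lia.
  have p'f : g' q < f' (g' q) by rewrite fg' // ggq.
  have [fpn ffp fpN] := f'1 _ gqn.
  (* The arc of g' q for f' must close before q, else it would cross the one ending at q. *)
  have fpq : f' (g' q) < q.
    have neq : f' (g' q) <> q by move=> e; rewrite e in ffp; lia.
    have : ~ (q < f' (g' q)) by move=> lt; apply: (f'2 (f' q) (g' q)); rewrite ?ffq.
    lia.
  have e := IH _ fpq; rewrite ffp in e; have {}e := e p'f.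
  have [_ ggr _] := g'1 _ fpn; rewrite -e ggq in ggr; lia.
have closing q : q < n -> f q < q -> f q = g q.
  elim/ltn_ind: q => q IH qn fq.
  have gq : g q < q by have [? ? ?] := gP.1 q qn; have := fg q qn; lia.
  have [lt|lt|//] := ltngtP (f q) (g q); exfalso.
    by apply: (step f g q) => // r rq fr; apply: IH => //; lia.
  apply: (step g f q) => // [p pn|r rq gr]; first by rewrite fg.
  have rn : r < n by lia.
  by apply/esym/IH => //; have [? ? ?] := fP.1 r rn; have := fg r rn; lia.
move=> p pn; have [fpn ffp fpN] := fP.1 p pn.
have [fp|pf|//] := ltngtP (f p) p; first exact: closing.
have := closing _ fpn; rewrite ffp => /(_ pf) e.
by rewrite [in RHS]e; have [_ -> _] := gP.1 _ fpn.
Qed.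

Definition join_pairings (m : nat) (f g : nat -> nat) (p : nat) : nat :=
  if p == 0 then m.+1 else if p == m.+1 then 0 else
  if p < m.+1 then (f p.-1).+1 else (g (p - m.+2) + m.+2).

Lemma pairing_on_join m l f g : pairing_on m f -> pairing_on l g ->
  pairing_on (m + l).+2 (join_pairings m f g).
Proof.
move=> [f1 f2] [g1 g2]; split=> [p pn|p q pq qf ffq fqn pn qn].
  rewrite /join_pairings; case: eqP => [->|p0].
    by rewrite eqxx /=; split; lia.
  case: eqP => [->|pm]; first by rewrite eqxx; split; lia.
  case: (ltnP p m.+1) => [ltpm|lepm].
    have pm' : p.-1 < m by lia.
    have [a b c] := f1 _ pm'.
    have -> : ((f p.-1).+1 == m.+1) = false by lia.
    have -> : ((f p.-1).+1 < m.+1) = true by lia.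
    by rewrite /= b; split; lia.
  have pm' : p - m.+2 < l by lia.
  have [a b c] := g1 _ pm'.
  have -> : (g (p - m.+2) + m.+2 == 0) = false by lia.
  have -> : (g (p - m.+2) + m.+2 == m.+1) = false by lia.
  have -> : (g (p - m.+2) + m.+2 < m.+1) = false by lia.
  by rewrite addnK b; split; lia.
move: qf ffq fqn; rewrite /join_pairings.
have f1q := f1 q.-1; have g1q := g1 (q - m.+2).
have f1p := f1 p.-1; have g1p := g1 (p - m.+2).
have f2pq := f2 p.-1 q.-1; have g2pq := g2 (p - m.+2) (q - m.+2).
case: eqP => [p0|p0].
  case: eqP => [|q0]; first by lia.
  case: eqP => [|qm]; first by lia.
  case: (ltnP q m.+1) => [ltq a b|]; last by lia.
  by have [|? ? ?] := f1q; lia.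
case: eqP => [|pm]; first by lia.
case: (eqVneq q 0) => [|q0]; first by lia.
case: (eqVneq q m.+1) => [|qm]; first by lia.
case: (ltnP p m.+1) => ltp; case: (ltnP q m.+1) => ltq qf ffq fqn.
- by have [|? ? ?] := f1q; [lia|]; apply: f2pq; lia.
- by have [|? ? ?] := f1p; lia.
- by lia.
- by have [|? ? ?] := g1q; [lia|]; apply: g2pq; lia.
Qed.

Lemma openings_on_join m l f g : pairing_on m f -> pairing_on l g ->
  openings_on (m + l).+2 (join_pairings m f g) =
  0 :: [seq p.+1 | p <- openings_on m f] ++ [seq m.+2 + p | p <- openings_on l g].
Proof.
move=> [f1 f2] [g1 g2].
have ei : iota 0 (m + l).+2 = 0 :: iota 1 m ++ m.+1 :: iota m.+2 l.
  by rewrite -(addnS m l) -[iota 0 _.+1]/(0 :: iota 1 (m + l.+1)) iotaD.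
rewrite /openings_on ei /= filter_cat /=; congr (_ :: _ ++ _).
  rewrite (iotaDl 1 0) filter_map; congr (map _ _).
  apply: eq_in_filter => p; rewrite mem_iota /= => pm.
  by rewrite /join_pairings add1n eqSS (ltn_eqF pm) ltnS pm.
rewrite {1}/join_pairings eqxx /= -[in iota _ l](addn0 m.+2) iotaDl filter_map.
congr (map _ _); apply: eq_in_filter => p; rewrite mem_iota /= => pl.
have -> : join_pairings m f g (m.+2 + p) = m.+2 + g p.
  rewrite /join_pairings !ifN ?addKn ?[g p + _]addnC //; lia.
by rewrite ltn_add2l.
Qed.

Lemma pairing_on_split n f : pairing_on n.+1 f ->
  exists m l g h, [/\ n = (m + l).+1, pairing_on m g, pairing_on l h &
    forall p, p < n.+1 -> f p = join_pairings m g h p].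
Proof.
move=> [f1 f2]; have [f0n ff0 f0N] := f1 0 isT.
pose m := (f 0).-1; have em : f 0 = m.+1 by rewrite /m; lia.
pose l := (n - m.+1).
have en : n = (m + l).+1 by rewrite /l; lia.
have inner p : p < m -> [/\ 0 < f p.+1, f p.+1 < m.+1, f (f p.+1) = p.+1 & f p.+1 <> p.+1].
  move=> pm; have pn : p.+1 < n.+1 by lia.
  have [a b c] := f1 _ pn.
  have n0 : f p.+1 <> 0 by move=> e; rewrite e in b; lia.
  have nm : f p.+1 <> m.+1 by move=> e; rewrite e -em ff0 in b.
  have : ~ (m.+1 < f p.+1) by move=> lt; apply: (f2 0 p.+1); lia.
  by split=> //; lia.
have outer p : p < l ->
    [/\ m.+1 < f (m.+2 + p), f (m.+2 + p) < n.+1, f (f (m.+2 + p)) = m.+2 + p & f (m.+2 + p) <> m.+2 + p].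
  move=> pl; have pn : m.+2 + p < n.+1 by lia.
  have [a b c] := f1 _ pn; split=> //.
  have n0 : f (m.+2 + p) <> 0 by move=> e; rewrite e in b; lia.
  have nm : f (m.+2 + p) <> m.+1 by move=> e; rewrite e -em ff0 in b.
  have : ~ (f (m.+2 + p) < m.+1) by move=> lt; apply: (f2 0 (f (m.+2 + p))); rewrite ?b; lia.
  lia.
exists m, l, (fun p => (f p.+1).-1), (fun p => (f (m.+2 + p) - m.+2)); split=> //.
- split=> [p /inner[a b c d]|p q pq qf ffq _ pm qm].
    by rewrite prednK //; split; lia.
  have [a b c d] := inner _ pm; have [a' b' c' d'] := inner _ qm.
  by apply: (f2 p.+1 q.+1); lia.
- split=> [p /outer[a b c d]|p q pq qf ffq _ pm qm].
    by rewrite subnKC ?c //; split; lia.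
  have [a b c d] := outer _ pm; have [a' b' c' d'] := outer _ qm.
  by apply: (f2 (m.+2 + p) (m.+2 + q)); lia.
move=> p pn; rewrite /join_pairings.
case: eqP => [->//|p0]; case: eqP => [->|pm]; first by rewrite -em ff0.
case: ltnP => ltp.
  have pm' : p.-1 < m by lia.
  have [a b _ _] := inner _ pm'.
  have e : p.-1.+1 = p by lia.
  by rewrite e in a b *; lia.
have pl : p - m.+2 < l by lia.
have [a b _ _] := outer _ pl.
have e : m.+2 + (p - m.+2) = p by lia.
by rewrite e in a b *; lia.
Qed.

Lemma pairing_on_eq n f g : (forall p, p < n -> f p = g p) ->
  pairing_on n f -> pairing_on n g.
Proof.
move=> fg [f1 f2]; split=> [p pn|p q pq].
  by have [a b c] := f1 p pn; rewrite -!fg // -?fg.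
move=> + + + pn qn; rewrite -!fg //; move=> *; exact: (f2 p q).
Qed.

Lemma tree_of_pairing n f : pairing_on n f ->
  exists2 t, n = (nodes t).*2 & openings_on n f = opening_points 0 t.
Proof.
elim/ltn_ind: n f => -[|n] IH f fP; first by exists Leaf.
have [m [l [g [h [en gP hP efj]]]]] := pairing_on_split fP.
have [|a ea oa] := IH m _ g gP; first by lia.
have [|b eb ob] := IH l _ h hP; first by lia.
exists (Node a b); first by rewrite /= en ea eb; lia.
have -> : openings_on n.+1 f = openings_on (m + l).+2 (join_pairings m g h).
  rewrite -en; apply: eq_in_filter => p; rewrite mem_iota /= => pn.
  by rewrite efj.
rewrite openings_on_join // oa ob /= add0n -ea.
by rewrite -[in RHS](addn0 m.+2) opening_points_shift -[1]/(1 + 0) opening_points_shift.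
Qed.

Lemma pairing_of_tree t : exists f,
  pairing_on (nodes t).*2 f /\ openings_on (nodes t).*2 f = opening_points 0 t.
Proof.
elim: t => [|a [f [fP ef]] b [g [gP eg]]]; first by exists id; split.
exists (join_pairings (nodes a).*2 f g).
have e : (nodes (Node a b)).*2 = ((nodes a).*2 + (nodes b).*2).+2 by rewrite /=; lia.
rewrite e; split; first exact: pairing_on_join.
rewrite openings_on_join // ef eg /= add0n.
by rewrite -[in RHS](addn0 _.+2) opening_points_shift -[1]/(1 + 0) opening_points_shift.
Qed.

Lemma openings_on_inj n f g : pairing_on n f -> pairing_on n g ->
  openings_on n f = openings_on n g -> forall p, p < n -> f p = g p.
Proof.
move=> fP gP e; apply: pairing_on_inj => // p pn.
have := congr1 (fun s => p \in s) e.
by rewrite !mem_filter mem_iota add0n pn !andbT.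
Qed.

Lemma opening_points_inj : injective (opening_points 0).
Proof.
have inj n t t' : nodes t = n -> opening_points 0 t = opening_points 0 t' -> t = t'.
  elim/ltn_ind: n t t' => n IH [|a b] [|a' b'] //= en [].
  have [f [fP ef]] := pairing_of_tree a; have [g [gP eg]] := pairing_of_tree b.
  have [f' [f'P ef']] := pairing_of_tree a'; have [g' [g'P eg']] := pairing_of_tree b'.
  rewrite !add0n => e.
  have enab : nodes a + nodes b = nodes a' + nodes b'.
    by have := congr1 size e; rewrite !size_cat !size_opening_points.
  have shift s : opening_points 1 s = [seq x.+1 | x <- opening_points 0 s].
    by rewrite -[1]/(1 + 0) opening_points_shift.
  have shift2 m s : opening_points m.+2 s = [seq m.+2 + x | x <- opening_points 0 s].
    by rewrite -[in LHS](addn0 m.+2) opening_points_shift.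
  (* Both trees come from pairings with the same opening points, so that the arc of 0 is the same. *)
  have ea : (nodes a).*2 = (nodes a').*2.
    have := @openings_on_inj _ _ _ (pairing_on_join fP gP) _ _ 0 isT.
    have := pairing_on_join f'P g'P.
    have -> : ((nodes a').*2 + (nodes b').*2).+2 = ((nodes a).*2 + (nodes b).*2).+2 by lia.
    move=> P2 /(_ _ P2); rewrite /join_pairings /= => inj0; apply: succn_inj; apply: inj0.
    rewrite (openings_on_join fP gP) ef eg.
    have -> : ((nodes a).*2 + (nodes b).*2).+2 = ((nodes a').*2 + (nodes b').*2).+2 by lia.
    by rewrite (openings_on_join f'P g'P) ef' eg' -!shift -!shift2 e.
  move/eqP: e; rewrite eqseq_cat; last by rewrite !size_opening_points; lia.
  rewrite !shift !shift2 ea => /andP[/eqP/(inj_map succn_inj) e1 /eqP/(inj_map (@addnI _)) e2].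
  have lta : nodes a < n by rewrite -en ltnS leq_addr.
  have ltb : nodes b < n by rewrite -en ltnS leq_addl.
  by rewrite (IH _ lta a a' erefl e1) (IH _ ltb b b' erefl e2).
by move=> t t'; apply: inj.
Qed.

(** The first argument bounds the depth of the recursion; any value larger than
    [n] gives the same list, see [trees_fuelE]. *)
Fixpoint trees_fuel (f n : nat) : seq tree :=
  if f is f'.+1 then
    if n is n'.+1 then
      [seq Node p.1 p.2 | i <- iota 0 n,
         p <- [seq (a, b) | a <- trees_fuel f' i, b <- trees_fuel f' (n' - i)]]
    else [:: Leaf]
  else [::].

Definition trees n := trees_fuel n.+1 n.

Lemma trees_fuelE f n : n < f -> trees_fuel f n = trees n.
Proof.
suff stable g g' : n < g -> n < g' -> trees_fuel g n = trees_fuel g' n by move/stable; apply.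
elim/ltn_ind: n g g' => -[_ [|g] [|g'] //|n IH [|g] [|g'] // ng ng'].
rewrite /trees_fuel -/trees_fuel; congr flatten; apply/eq_in_map => i.
rewrite mem_iota add0n => /= lti.
have lti' : n - i < n.+1 by rewrite ltnS leq_subr.
by rewrite (IH i lti g g') ?(IH _ lti' g g') //; lia.
Qed.

Lemma treesS n : trees n.+1 =
  [seq Node p.1 p.2 | i <- iota 0 n.+1,
     p <- [seq (a, b) | a <- trees i, b <- trees (n - i)]].
Proof.
have -> : trees n.+1 = [seq Node p.1 p.2 | i <- iota 0 n.+1,
    p <- [seq (a, b) | a <- trees_fuel n.+1 i, b <- trees_fuel n.+1 (n - i)]] by [].
congr flatten; apply/eq_in_map => i; rewrite mem_iota add0n => /andP[_ lti].
by rewrite !trees_fuelE // ltnS leq_subr.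
Qed.

Lemma mem_trees n t : (t \in trees n) = (nodes t == n).
Proof.
elim/ltn_ind: n t => -[|n] IH t.
  by rewrite /trees /= inE; case: t => [|a b]; rewrite ?eqxx //=; apply/eqP.
rewrite treesS; apply/allpairsPdep/eqP => [[i [p [+ + ->]]]|].
  rewrite mem_iota add0n => /andP[_ lti] /allpairsP[[a b] [/= + + ->]] /=.
  have lti' : n - i < n.+1 by rewrite ltnS leq_subr.
  by rewrite (IH i lti) (IH _ lti'); lia.
case: t => [//|a b] [e]; exists (nodes a), (a, b).
rewrite mem_iota add0n ltnS -e leq_addr; split=> //.
apply/allpairsP; exists (a, b) => /=.
by rewrite !IH ?eqxx ?addKn ?eqxx //; move: e; lia.
Qed.

Lemma uniq_trees n : uniq (trees n).
Proof.
elim/ltn_ind: n => -[|n] IH //; rewrite treesS.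
apply: allpairs_uniq_dep; first exact: iota_uniq.
  move=> i; rewrite mem_iota => /= lti; apply: allpairs_uniq; try by apply: IH; lia.
  by move=> [? ?] [? ?].
move=> u v /allpairsPdep[i [[a b] [_ + ->]]] /allpairsPdep[j [[a' b'] [_ + ->]]] /=.
case/allpairsP=> -[? ?] /= [ai _ [-> ->]] /allpairsP[[? ?] /= [aj _ [-> ->]]] [ea eb].
by move: ai aj; rewrite !mem_trees ea eb => /eqP-> /eqP->.
Qed.

End Pairings.

Lemma big_trees (V : nmodType) n (F : tree -> V) :
  \sum_(t <- trees n.+1) F t =
  \sum_(i < n.+1) \sum_(a <- trees i) \sum_(b <- trees (n - i)) F (Node a b).
Proof.
rewrite treesS big_allpairs_dep -(big_mkord xpredT (fun i =>
  \sum_(a <- trees i) \sum_(b <- trees (n - i)) F (Node a b))).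
by rewrite /index_iota subn0; apply: eq_bigr => i _; rewrite big_allpairs.
Qed.

Definition ord_fun n (T : {ffun 'I_n -> 'I_n}) (p : nat) : nat :=
  if insub p is Some i then T i else 0%N.

Lemma ord_funE n (T : {ffun 'I_n -> 'I_n}) (i : 'I_n) : ord_fun T i = T i.
Proof. by rewrite /ord_fun valK. Qed.

Lemma openingsE n (T : {ffun 'I_n -> 'I_n}) : openings T = openings_on n (ord_fun T).
Proof.
rewrite /openings_on -(val_enum_ord n) filter_map; congr (map _ _).
by apply: eq_filter => i /=; rewrite ord_funE.
Qed.

Lemma noncrossing_pairingP n (T : {ffun 'I_n -> 'I_n}) :
  reflect (pairing_on n (ord_fun T)) (noncrossing_pairing T).
Proof.
apply: (iffP idP) => [/andP[/forallP T1 /forallP T2]|[T1 T2]].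
  split=> [p pn|p q pq + + _ pn qn].
    rewrite -[p]/(val (Ordinal pn)) !ord_funE.
    have /andP[/eqP TT /eqP TN] := T1 (Ordinal pn).
    by rewrite TT; split=> // e; apply: TN; apply: val_inj.
  rewrite -[p]/(val (Ordinal pn)) -[q]/(val (Ordinal qn)) !ord_funE => qT TT.
  by have /forallP/(_ (Ordinal qn)) := T2 (Ordinal pn); rewrite /= pq qT TT.
apply/andP; split; apply/forallP => i.
  have [_ e1 e2] := T1 i (ltn_ord i); rewrite !ord_funE in e1 e2.
  by apply/andP; split; [apply/eqP/val_inj|apply/eqP => e; apply: e2; rewrite e].
apply/forallP => j; apply/negP => /and3P[ij jT TT].
by apply: (T2 i j); rewrite ?ord_funE ?ltn_ord.
Qed.

(** The state sum of a closed diagram sees a pairing only through its opening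
    points, so the sum over pairings becomes a sum over trees, which has the
    recursive form of [big_trees]. *)
Lemma sum_noncrossing_pairings (V : nmodType) m (F : seq nat -> V) :
  \sum_(T : {ffun 'I_(m.*2) -> 'I_(m.*2)} | noncrossing_pairing T) F (openings T) =
  \sum_(t <- trees m) F (opening_points 0 t).
Proof.
pose P := [pred T : {ffun 'I_(m.*2) -> 'I_(m.*2)} | noncrossing_pairing T].
transitivity (\sum_(T <- enum P) F (openings T)); first by rewrite big_enum.
rewrite -(big_map (@openings _) xpredT) -(big_map (opening_points 0) xpredT F).
apply: perm_big; apply: uniq_perm.
- rewrite map_inj_in_uniq; first by rewrite enum_uniq.
  move=> T T'; rewrite !mem_enum => /noncrossing_pairingP P1 /noncrossing_pairingP P2.
  rewrite !openingsE => e.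
  apply/ffunP => i; apply: val_inj; rewrite /= -!ord_funE.
  exact: (openings_on_inj P1 P2 e).
- by rewrite (map_inj_uniq opening_points_inj) uniq_trees.
move=> s; apply/mapP/mapP => [[T]|[t]].
  rewrite mem_enum => /noncrossing_pairingP P1 ->.
  have [t et ot] := tree_of_pairing P1; exists t; last by rewrite openingsE.
  by rewrite mem_trees; apply/eqP/double_inj.
rewrite mem_trees => /eqP et ->; have [f] := pairing_of_tree t.
rewrite et => -[fP ef].
pose T := [ffun i : 'I_(m.*2) => insubd i (f i)].
have eT p : (p < m.*2)%N -> f p = ord_fun T p.
  move=> pm; rewrite -[p]/(val (Ordinal pm)) ord_funE ffunE val_insubd.
  by have [-> _ _] := fP.1 _ pm.
exists T.
  rewrite mem_enum; apply/noncrossing_pairingP.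
  exact: pairing_on_eq fP.
rewrite openingsE -ef; apply: eq_in_filter => p; rewrite mem_iota /= => pm.
by rewrite eT.
Qed.

(** * State sums of arcs *)

Section StateSums.

Variables (C : numClosedFieldType) (G : finGroupType).

Lemma sum_tuple_cons n (F : seq G -> C) :
  \sum_(e : n.+1.-tuple G) F e = \sum_(v : G) \sum_(e : n.-tuple G) F (v :: e).
Proof.
rewrite pair_big /=.
rewrite (reindex (fun p : G * n.-tuple G => [tuple of p.1 :: p.2])) //=.
exists (fun e => (thead e, [tuple of behead e])) => [[v e]|e] _ /=.
  by congr (_, _); apply: val_inj.
by apply: val_inj; rewrite [in RHS](tuple_eta e).
Qed.

Lemma sum_tuple_rcons n (F : seq G -> C) :
  \sum_(e : n.+1.-tuple G) F e = \sum_(v : G) \sum_(e : n.-tuple G) F (rcons e v).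
Proof.
have rev_sum m (H : seq G -> C) :
    \sum_(e : m.-tuple G) H e = \sum_(e : m.-tuple G) H (rev e).
  by apply: (reindex_inj (inv_inj (_ : involutive (@rev_tuple m G)))) => e;
    apply: val_inj; rewrite /= revK.
rewrite rev_sum (sum_tuple_cons n (fun e => F (rev e))); apply: eq_bigr => v _.
rewrite (rev_sum n (fun e => F (rcons e v))).
by under eq_bigr do rewrite rev_cons.
Qed.

Lemma sum_tuple_delta n s (F : seq G -> C) : size s = n ->
  \sum_(e : n.-tuple G) F e * (val e == s)%:R = F s.
Proof.
move/eqP => sn; rewrite (bigD1 (Tuple sn)) //= eqxx mulr1 big1 ?addr0 // => e ne.
suff -> : val e == s = false by rewrite mulr0.
by apply: contraNF ne => /eqP es; apply/eqP/val_inj.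
Qed.

Lemma sum_tuple_mem n (S : seq (seq G)) (F : seq G -> C) :
    uniq S -> (forall s, s \in S -> size s = n) ->
  \sum_(e : n.-tuple G) F e * (val e \in S)%:R = \sum_(s <- S) F s.
Proof.
elim: S => [|s S IH] /= => [_ _|/andP[sS uS] szS].
  by rewrite big_nil big1 // => e _; rewrite mulr0.
rewrite big_cons -IH //; last by move=> t tS; apply: szS; rewrite inE tS orbT.
rewrite -(sum_tuple_delta F (szS s (mem_head _ _))) -big_split; apply: eq_bigr => e _ /=.
rewrite -mulrDr inE /=; congr (_ * _); case: eqP => [->|] /=; last by rewrite add0r.
by rewrite (negPf sS) addr0.
Qed.

Lemma sum_delta (v : G) (F : G -> C) : \sum_(g : G) F g * (g == v)%:R = F v.
Proof.
rewrite (bigD1 v) //= eqxx mulr1 big1 ?addr0 // => g /negPf->.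
by rewrite mulr0.
Qed.

(** The lists of spins that the pairing coded by a tree allows on the shaded
    intervals between its points. The pairing is drawn in an unshaded region
    for [None], and in a shaded region of spin [g] for [Some g]; the spin of the
    region to the left of the first point is left out of the list. Crossing an
    arc exchanges the two cases, and a new shaded region carries a free spin. *)
Fixpoint spins (t : tree) (o : option G) : seq (seq G) :=
  if t is Node a b then
    if o is Some g then [seq x ++ g :: y | x <- spins a None, y <- spins b (Some g)]
    else flatten [seq [seq g :: x ++ y | x <- spins a (Some g), y <- spins b None]
                 | g <- enum G]
  else [:: [::]].

Lemma size_spins t o s : s \in spins t o -> size s = nodes t.
Proof.
elim: t o s => [|a IHa b IHb] [g|] s /=; rewrite ?inE; try by move/eqP->.
  by case/allpairsP => -[x y] /= [/IHa sx /IHb sy ->]; rewrite size_cat /= sx sy addnS.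
case/flattenP => _ /mapP[g _ ->] /allpairsP[[x y] /= [/IHa sx /IHb sy ->]].
by rewrite /= size_cat sx sy.
Qed.

Lemma mem_spins_some a b g x h y : size x = nodes a ->
  (x ++ h :: y \in spins (Node a b) (Some g)) =
  [&& x \in spins a None, h == g & y \in spins b (Some g)].
Proof.
move=> sx; apply/allpairsP/and3P => [[[x' y'] /= [x'a y'b /eqP]]|[xa /eqP-> yb]].
  rewrite eqseq_cat ?eqseq_cons; last by rewrite sx (size_spins x'a).
  by case/and3P => /eqP-> /eqP-> /eqP->; rewrite x'a y'b.
by exists (x, y).
Qed.

Lemma mem_spins_none a b x h y : size x = nodes a ->
  (h :: x ++ y \in spins (Node a b) None) =
  (x \in spins a (Some h)) && (y \in spins b None).
Proof.
move=> sx; apply/flattenP/andP => [[_ /mapP[g _ ->]]|[xa yb]].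
  case/allpairsP => -[x' y'] /= [x'a y'b /eqP]; rewrite eqseq_cons => /andP[/eqP->].
  rewrite eqseq_cat; last by rewrite sx (size_spins x'a).
  by case/andP => /eqP-> /eqP->; rewrite x'a y'b.
exists [seq h :: x' ++ y' | x' <- spins a (Some h), y' <- spins b None].
  by apply/mapP; exists h; rewrite ?mem_enum.
by apply/allpairsP; exists (x, y).
Qed.

(** Outside all arcs the region is the one the pairing is drawn in. *)
Lemma last_spins t g s : s \in spins t (Some g) -> last g s = g.
Proof.
elim: t s => [|a _ b IHb] s /=; first by rewrite inE => /eqP->.
by case/allpairsP => -[x y] /= [_ yb ->]; rewrite last_cat /= IHb.
Qed.

Lemma uniq_spins t o : uniq (spins t o).
Proof.
elim: t o => [|a IHa b IHb] [g|] //=.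
  apply: allpairs_uniq => // -[x y] [x' y'] /allpairsP[[? ?] /= [xa _ [-> ->]]].
  case/allpairsP=> -[? ?] /= [xa' _ [-> ->]] /eqP.
  rewrite eqseq_cat ?eqseq_cons; last by rewrite (size_spins xa) (size_spins xa').
  by rewrite eqxx => /andP[/eqP-> /eqP->].
have -> : [seq [seq g :: x ++ y | x <- spins a (Some g), y <- spins b None] | g <- enum G] =
    [seq [seq g :: p.1 ++ p.2 | p <- [seq (x, y) | x <- spins a (Some g), y <- spins b None]]
    | g <- enum G].
  by apply: eq_map => g; rewrite map_allpairs.
apply: allpairs_uniq_dep; first exact: enum_uniq.
  by move=> g _; apply: allpairs_uniq => // -[? ?] [? ?].
move=> u v /allpairsPdep[g [[x y] [_ + ->]]] /allpairsPdep[h [[x' y'] [_ + ->]]] /=.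
case/allpairsP=> -[? ?] /= [xa _ [-> ->]] /allpairsP[[? ?] /= [xa' _ [-> ->]]] /eqP.
rewrite eqseq_cons eqseq_cat; last by rewrite (size_spins xa) (size_spins xa').
by case/and3P => /eqP-> /eqP-> /eqP->.
Qed.

Lemma sum_spins_some a b g (F : seq G -> C) :
  \sum_(s <- spins (Node a b) (Some g)) F s =
  \sum_(x <- spins a None) \sum_(y <- spins b (Some g)) F (x ++ g :: y).
Proof. by rewrite /= big_allpairs_dep. Qed.

Lemma sum_spins_none a b (F : seq G -> C) :
  \sum_(s <- spins (Node a b) None) F s =
  \sum_(g : G) \sum_(x <- spins a (Some g)) \sum_(y <- spins b None) F (g :: x ++ y).
Proof.
rewrite /= big_flatten big_map big_enum; apply: eq_bigr => g _.
by rewrite big_allpairs_dep.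
Qed.

Definition factor (s : seq nat) : C := \prod_(p <- s) extremum_factor C G p.

Lemma factor_cat s1 s2 : factor (s1 ++ s2) = factor s1 * factor s2.
Proof. exact: big_cat. Qed.

Lemma factor_cons p s : factor (p :: s) = extremum_factor C G p * factor s.
Proof. exact: big_cons. Qed.

Lemma order_neq0 : order_G C G != 0.
Proof. by rewrite pnatr_eq0 -lt0n -cardsT; apply/card_gt0P; exists 1%g; rewrite inE. Qed.

(** Moving an extremum by one string exchanges its shaded and unshaded sides. *)
Lemma extremum_factorK p : extremum_factor C G p * extremum_factor C G p.+1 = 1.
Proof.
have r0 : 4.-root (order_G C G) != 0 by rewrite rootC_eq0 ?order_neq0.
by rewrite /extremum_factor /=; case: odd; rewrite /= ?mulfV ?mulVf.
Qed.

Lemma extremum_factor_odd p q : odd p = odd q -> extremum_factor C G p = extremum_factor C G q.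
Proof. by rewrite /extremum_factor => ->. Qed.

(** In a closed diagram each arc above the box has a mirror image below it,
    three strings further to the right, hence with the opposite shading. *)
Lemma factor_shift3 s : factor s * factor [seq (3 + p)%N | p <- s] = 1.
Proof.
rewrite /factor big_map -big_split big1_seq //= => p _.
by rewrite (@extremum_factor_odd (3 + p)%N p.+1) ?extremum_factorK //= negbK.
Qed.

(** Drawing the arcs of a pairing above a line, starting at position [p], inserts
    into the list of shaded spins one of the lists of [spins]. The interval at
    [p] is unshaded for [p] even, and shaded of spin [g], the last spin to the
    left, for [p] odd. *)
Lemma state_sum_caps t p w c1 c2 d :
  (~~ odd p -> size c1 = p./2 ->
    state_sum ([seq Cap C G q | q <- opening_points p t] ++ w) (c1 ++ c2) d =
    factor (opening_points p t) *
    \sum_(s <- spins t None) state_sum w (c1 ++ s ++ c2) d) /\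
  (forall g, odd p -> size c1 = p./2 ->
    state_sum ([seq Cap C G q | q <- opening_points p t] ++ w) (rcons c1 g ++ c2) d =
    factor (opening_points p t) *
    \sum_(s <- spins t (Some g)) state_sum w (rcons c1 g ++ s ++ c2) d).
Proof.
elim: t p w c1 c2 => [|a IHa b IHb] p w c1 c2.
  by split=> * /=; rewrite /factor big_nil big_seq1 mul1r.
have odd2 : odd (p + (nodes a).*2.+2) = odd p by rewrite oddD /= odd_double negbK addbF.
have half2 : (p + (nodes a).*2.+2)./2 = (p./2 + (nodes a).+1)%N.
  by rewrite -doubleS halfD odd_double andbF doubleK.
have half1 : (p.+1)./2 = (odd p + p./2)%N by rewrite -uphalfE uphalf_half.
split=> [|g] op sc; rewrite /= map_cat -catA ?(negPf op) ?op factor_cons -mulrA; congr (_ * _).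
- rewrite -sc take_size_cat // drop_size_cat // sum_spins_none mulr_sumr.
  apply: eq_bigr => g _; rewrite -cat_rcons.
  rewrite (IHa p.+1 _ c1 c2).2 //; last by rewrite half1 (negPf op).
  rewrite factor_cat -mulrA; congr (_ * _); rewrite mulr_sumr !big_seq.
  apply: eq_bigr => x /size_spins sx; rewrite catA (IHb _ w _ c2).1 ?odd2 //.
    by congr (_ * _); apply: eq_bigr => y _; rewrite /= -!catA cat_rcons.
  by rewrite size_cat size_rcons sx half2 sc addnS.
- have -> : take p./2.+1 (rcons c1 g ++ c2) = rcons c1 g.
    by rewrite take_size_cat // size_rcons sc.
  have -> : drop p./2 (rcons c1 g ++ c2) = g :: c2 by rewrite cat_rcons -sc drop_size_cat.
  rewrite (IHa p.+1 _ _ (g :: c2)).1 /= ?op // ; last by rewrite size_rcons sc; lia.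
  rewrite sum_spins_some factor_cat -mulrA; congr (_ * _); rewrite mulr_sumr !big_seq.
  apply: eq_bigr => x /size_spins sx.
  rewrite -[x ++ g :: c2]cat_rcons catA -rcons_cat.
  rewrite (IHb _ w _ c2).2 ?odd2 //; last by rewrite size_cat size_rcons sx half2 sc addSnnS.
  by congr (_ * _); apply: eq_bigr => y _; rewrite rcons_cat -!catA !cat_rcons.
Qed.

(** The mirror image of [state_sum_caps]: arcs below a line test that the
    spins they meet are among the allowed ones, and erase them. *)
Lemma state_sum_cups t p w c1 s c2 d : size s = nodes t ->
  (~~ odd p -> size c1 = p./2 ->
    state_sum (rev [seq Cup C G q | q <- opening_points p t] ++ w) (c1 ++ s ++ c2) d =
    factor (opening_points p t) * (s \in spins t None)%:R * state_sum w (c1 ++ c2) d) /\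
  (forall g, odd p -> size c1 = p./2 ->
    state_sum (rev [seq Cup C G q | q <- opening_points p t] ++ w) (rcons c1 g ++ s ++ c2) d =
    factor (opening_points p t) * (s \in spins t (Some g))%:R *
    state_sum w (rcons c1 g ++ c2) d).
Proof.
elim: t p w c1 s c2 => [|a IHa b IHb] p w c1 s c2.
  by move/size0nil=> ->; split=> * /=; rewrite /factor big_nil !mul1r.
rewrite [nodes _]/= [opening_points _ _]/= => ss.
have odd2 : odd (p + (nodes a).*2.+2) = odd p by rewrite oddD /= odd_double negbK addbF.
have half2 : (p + (nodes a).*2.+2)./2 = (p./2 + (nodes a).+1)%N.
  by rewrite -doubleS halfD odd_double andbF doubleK.
have half1 : (p.+1)./2 = (odd p + p./2)%N by rewrite -uphalfE uphalf_half.
split=> [|g] op sc; rewrite map_cons rev_cons map_cat rev_cat cat_rcons -!catA factor_cons factor_cat.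
- case: s ss => [//|h s] [ss].
  have [x [y [es sx]]] : exists x y, s = x ++ y /\ size x = nodes a.
    by apply: cat_split; rewrite ss leq_addr.
  have sy : size y = nodes b by move: ss; rewrite es size_cat sx => /addnI.
  have -> : c1 ++ (h :: s) ++ c2 = (rcons c1 h ++ x) ++ y ++ c2.
    by rewrite es -!catA cat_rcons /= -catA.
  rewrite es mem_spins_none // -mulnb natrM.
  rewrite (IHb _ _ _ _ c2 sy).1 ?odd2 //; last by rewrite size_cat size_rcons sx half2 sc addnS.
  rewrite -catA (IHa _ _ _ _ c2 sx).2 //; last by rewrite half1 (negPf op).
  rewrite /= (negPf op) mulr1 cat_rcons -sc take_size_cat //.
  by rewrite -cat_rcons drop_size_cat ?size_rcons //; ring.
- have [x [y' [es sx]]] : exists x y, s = x ++ y /\ size x = nodes a.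
    by apply: cat_split; rewrite ss leqW // leq_addr.
  case: y' es => [|h y] es.
    by move: ss; rewrite es cats0 sx; lia.
  have sy : size y = nodes b.
    by move: ss; rewrite es size_cat /= sx; lia.
  have -> : rcons c1 g ++ s ++ c2 = rcons (rcons c1 g ++ x) h ++ y ++ c2.
    by rewrite es [in RHS]cat_rcons -!catA cat_cons.
  rewrite es mem_spins_some // -!mulnb !natrM.
  rewrite (IHb _ _ _ _ c2 sy).2 ?odd2 //; last by rewrite size_cat size_rcons sx half2 sc addSnnS.
  rewrite [rcons (_ ++ _) h ++ c2]cat_rcons -[(_ ++ x) ++ _]catA.
  rewrite (IHa _ _ _ _ (h :: c2) sx).1 /= ?op //; last by rewrite size_rcons sc; lia.
  have -> : onth (rcons c1 g ++ h :: c2) p./2 = Some g.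
    by rewrite cat_rcons -sc; elim: (c1).
  have /= -> : onth (rcons c1 g ++ h :: c2) p./2.+1 = Some h.
    by rewrite -sc; elim: (c1).
  have -> : take p./2 (rcons c1 g ++ h :: c2) = c1 by rewrite cat_rcons -sc take_size_cat.
  have -> : drop p./2.+1 (rcons c1 g ++ h :: c2) = h :: c2.
    by rewrite drop_size_cat // size_rcons sc.
  rewrite -cat_rcons [Some g == _]eq_sym.
  have -> : (Some h == Some g) = (h == g) by [].
  by case: eqP => [->|_] /=; ring.
Qed.

End StateSums.

(** * Kernels of boxes, concatenation and closure *)

Section Kernels.

Variables (C : numClosedFieldType) (G : finGroupType).
Notation width m := (m.*2 + 3)%N.
Local Notation box := (box C G).
Local Notation order := (order_G C G).

(** The spins of a box in clockwise order from the top left corner: the bottom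
    ones [bs], given from left to right, are met in reverse order. *)
Definition kernel m (a : box (width m)) (ts : seq G) (r : G) (bs : seq G) (l : G) : C :=
  eval_label a (ts ++ r :: rev bs ++ [:: l]).

Lemma state_sum_Box i m (a : box (width m)) w c1 x y c2 d :
  size c1 = i -> size x = m.+1 ->
  state_sum (Box i.*2 a :: w) (c1 ++ x ++ y :: c2) d =
  \sum_(e : m.+1.-tuple G)
    eval_label a (rcons x y ++ rev e) * state_sum w (c1 ++ e ++ y :: c2) d.
Proof.
move=> sc sx /=; have hw : (width m)./2 = m.+1 by lia.
have uw : uphalf (width m) = m.+2 by lia.
have drop1 : drop i (c1 ++ x ++ y :: c2) = x ++ y :: c2 by rewrite -sc drop_size_cat.
have drop2 : drop (i + m.+1) (c1 ++ x ++ y :: c2) = y :: c2.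
  by rewrite addnC -drop_drop drop1 -sx drop_size_cat.
have take1 : take i (c1 ++ x ++ y :: c2) = c1 by rewrite -sc take_size_cat.
rewrite uw hw doubleK drop1 drop2 take1.
by rewrite -cat_rcons take_size_cat ?size_rcons ?sx.
Qed.

Lemma kernelE m (a : box (width m)) ts r bs y l :
  kernel a ts r (rcons bs y) l = eval_label a ((ts ++ [:: r; y]) ++ rev (l :: bs)).
Proof. by rewrite /kernel rev_rcons rev_cons -catA /= -cats1. Qed.

Lemma state_sum_Box_kernel i m (a : box (width m)) w c1 ts r y c2 d :
  size c1 = i -> size ts = m ->
  state_sum (Box i.*2 a :: w) (c1 ++ ts ++ [:: r, y & c2]) d =
  \sum_(l : G) \sum_(bs : m.-tuple G)
    kernel a ts r (rcons bs y) l * state_sum w (c1 ++ l :: bs ++ y :: c2) d.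
Proof.
move=> sc st; have -> : ts ++ [:: r, y & c2] = rcons ts r ++ y :: c2 by rewrite cat_rcons.
rewrite state_sum_Box ?size_rcons ?st // (sum_tuple_cons _ (fun e =>
  eval_label a (rcons (rcons ts r) y ++ rev e) * state_sum w (c1 ++ e ++ y :: c2) d)).
apply: eq_bigr => l _; apply: eq_bigr => bs _.
by rewrite kernelE -!cats1 -!catA.
Qed.

Lemma kernel_tangle m w ts r bs y l : size ts = m -> size bs = m ->
  kernel (tangle (width m) w : box (width m)) ts r (rcons bs y) l =
  state_sum w (ts ++ [:: r; y]) (l :: rcons bs y).
Proof.
move=> st sb; rewrite kernelE.
have hw : (width m)./2 = m.+1 by lia.
have se : size (l :: bs) == (width m)./2 by rewrite hw /= sb.
rewrite (eval_tangle w (Tuple se)) /=; last by rewrite size_cat st /=; lia.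
rewrite hw -[ts ++ _]cat_rcons -cats1 drop_size_cat ?cats1 //.
by rewrite size_rcons st.
Qed.

(** The right spin of [a] is the left spin of [b], which is summed over, and the
    bottom right interval of [a] is the bottom left interval of [b]. *)
Lemma kernel_concat n i j (a : box (width i)) (b : box (width j)) ts1 ts2 r bs1 y bs2 l :
  n = (i + j)%N ->
  size ts1 = i -> size ts2 = j -> size bs1 = i -> size bs2 = j ->
  kernel (concat n a b) (ts1 ++ ts2) r (bs1 ++ rcons bs2 y) l =
  \sum_(v : G) kernel a ts1 v (rcons bs1 (head y bs2)) l *
               kernel b ts2 r (rcons bs2 y) v.
Proof.
move=> -> st1 st2 sb1 sb2; rewrite -rcons_cat kernel_tangle; first last.
- by rewrite size_cat sb1 sb2.
- by rewrite size_cat st1 st2.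
rewrite /concat_tangle -catA state_sum_Box_kernel //.
apply: eq_bigr => v _.
transitivity (\sum_(bs : j.-tuple G) (kernel b ts2 r (rcons bs y) v *
    kernel a ts1 v (rcons bs1 (head y bs)) l) * (val bs == bs2)%:R).
  apply: eq_bigr => bs _; rewrite -mulrA; congr (_ * _).
  have -> : ts1 ++ v :: bs ++ [:: y] = [::] ++ ts1 ++ [:: v, head y bs & behead (bs ++ [:: y])].
    by rewrite /=; case: (tval bs).
  rewrite -[0%N]/(0.*2) state_sum_Box_kernel //.
  have e : head y bs :: behead (bs ++ [:: y]) = rcons bs y.
    by rewrite cats1; case: (tval bs).
  transitivity (\sum_(u : G) \sum_(cs : i.-tuple G)
     (kernel a ts1 v (rcons cs (head y bs)) u * (val bs == bs2)%:R * (u == l)%:R) * (val cs == bs1)%:R).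
    apply: eq_bigr => u _; apply: eq_bigr => cs _; rewrite -!mulrA; congr (_ * _).
    rewrite /= e eqseq_cons -rcons_cat eqseq_rcons eqxx andbT eqseq_cat ?size_tuple ?sb1 //.
    by rewrite -!mulnb !natrM; ring.
  transitivity (\sum_(u : G) (kernel a ts1 v (rcons bs1 (head y bs)) u * (val bs == bs2)%:R) * (u == l)%:R).
    apply: eq_bigr => u _.
    by rewrite (sum_tuple_delta (fun cs => kernel a ts1 v (rcons cs (head y bs)) u * (val bs == bs2)%:R * (u == l)%:R) sb1).
  by rewrite (sum_delta l (fun u => kernel a ts1 v (rcons bs1 (head y bs)) u * (val bs == bs2)%:R)).
rewrite (sum_tuple_delta (fun bs => kernel b ts2 r (rcons bs y) v *
    kernel a ts1 v (rcons bs1 (head y bs)) l) sb2).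
by rewrite mulrC.
Qed.

Lemma order_gt0 : 0 < order.
Proof. by rewrite lt0r order_neq0 ler0n. Qed.

(** The normalization of the three strings that join the right side of a box to
    its left side. *)
Lemma root4_sqr : (4.-root order) ^+ 2 = sqrtC order.
Proof.
have o0 := ltW order_gt0.
have r0 : 0 <= 4.-root order by rewrite rootC_ge0.
by apply: (@pexpIrn _ 2) => //; rewrite ?nnegrE ?exprn_ge0 ?sqrtC_ge0 // -exprM rootCK // sqrtCK.
Qed.

Definition closure_along m (a : box (width m)) (s : seq nat) : C :=
  state_sum ([seq Cap C G i | i <- iota 0 3] ++ [seq Cap C G p | p <- s] ++
    [:: Box 0 a] ++
    rev [seq Cup C G (3 + p)%N | p <- s] ++ rev [seq Cup C G i | i <- iota 0 3])
    [::] [::].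

(** Six extrema join the two sides of the box, with total factor n^(-1/2). The
    shaded region above the pairing at the bottom is the one below the third
    string, of spin [y]; the top pairing is drawn in an unshaded region. *)
Lemma closure_alongE m (a : box (width m)) t : nodes t = m ->
  closure_along a (opening_points 0 t) = (sqrtC order)^-1 *
    \sum_(r : G) \sum_(ts <- spins t None) \sum_(y : G) \sum_(bs <- spins t (Some y))
      kernel a ts r (y :: bs) r.
Proof.
move=> tm; rewrite /closure_along.
set r4 := 4.-root order.
have r4_neq0 : r4 != 0 by rewrite rootC_eq0 ?order_neq0.
set w := _ ++ _ ++ rev _ ++ _.
have wE u y : state_sum w [:: u; y; u] [::] = r4^-1 *
    \sum_(ts <- spins t None) \sum_(bs : m.-tuple G)
      kernel a ts u (rcons bs y) u *
      (behead (rcons bs y) \in spins t (Some (head 1%g (rcons bs y))))%:R.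
  rewrite /w -[[:: u; y; u]]cat0s (state_sum_caps t 0 _ [::] _ _).1 //.
  rewrite !mulr_sumr !big_seq; apply: eq_bigr => ts /size_spins; rewrite tm => st.
  rewrite cat1s -[Box 0 a]/(Box 0.*2 a) state_sum_Box_kernel //.
  (* Only [l = u] survives: the right and left corridors are joined. *)
  pose F l := r4^-1 * \sum_(bs : m.-tuple G) kernel a ts u (rcons bs y) l *
      (behead (rcons bs y) \in spins t (Some (head 1%g (rcons bs y))))%:R.
  rewrite -[RHS](sum_delta u F) mulr_sumr; apply: eq_bigr => l _.
  rewrite /F !mulr_sumr mulr_suml.
  apply: eq_bigr => bs _.
  have sb : size (behead (rcons bs y)) = nodes t by rewrite size_behead size_rcons size_tuple tm.
  have -> : [::] ++ l :: bs ++ [:: y; u] =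
      rcons [:: l] (head 1%g (rcons bs y)) ++ behead (rcons bs y) ++ [:: u].
    by case: (tval bs) => [|h s] //=; rewrite cat_rcons.
  have -> : [seq Cup C G (3 + p) | p <- opening_points 0 t] =
      [seq Cup C G p | p <- opening_points 3 t].
    by rewrite -[3%N in RHS]addn0 opening_points_shift -map_comp.
  rewrite (state_sum_cups 3 _ [:: l] [:: u] _ sb).2 //=.
  have := factor_shift3 C G (opening_points 0 t).
  rewrite -opening_points_shift addn0 => ff.
  have -> : (Some l == Some u) = (l == u) by [].
  rewrite /extremum_factor /= -/r4.
  rewrite -[RHS]mul1r -[X in _ = X * _]ff; set k := kernel _ _ _ _ _.
  by field.
have sumE u : \sum_(y : G) state_sum w [:: u; y; u] [::] = r4^-1 *
    \sum_(ts <- spins t None) \sum_(y : G) \sum_(bs <- spins t (Some y))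
      kernel a ts u (y :: bs) u.
  under eq_bigr => y _ do rewrite wE.
  rewrite -mulr_sumr exchange_big /=; congr (_ * _); apply: eq_bigr => ts _.
  rewrite -(sum_tuple_rcons _ (fun e => kernel a ts u e u *
    (behead e \in spins t (Some (head 1%g e)))%:R)).
  rewrite (sum_tuple_cons _ (fun e => kernel a ts u e u *
    (behead e \in spins t (Some (head 1%g e)))%:R)).
  apply: eq_bigr => y _ /=.
  apply: (sum_tuple_mem (fun bs => kernel a ts u (y :: bs) u)); first exact: uniq_spins.
  by move=> s /size_spins; rewrite tm.
rewrite [LHS]/= /extremum_factor /= -/r4 -root4_sqr -/r4.
rewrite [LHS]mulr_sumr [RHS]mulr_sumr; apply: eq_bigr => u _.
by rewrite sumE; field.
Qed.

End Kernels.

(** * Words in Z and elements of degree zero *)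

Section Words.

Variables (C : numClosedFieldType) (G : finGroupType).
Notation width m := (m.*2 + 3)%N.
Local Notation box := (box C G).
Local Notation graded := (graded C G 3).
Local Notation Z := (Z_element C G).
Local Notation order := (order_G C G).

Lemma kernel_inj m (a b : box (width m)) :
  (forall ts r bs l, size ts = m -> size bs = m.+1 ->
     kernel a ts r bs l = kernel b ts r bs l) -> a = b.
Proof.
move=> ab; apply/val_inj/ffunP => t; rewrite -!eval_label_tuple.
have [|ts [c [et st]]] := @cat_split G t m; first by rewrite size_tuple; lia.
have sc : size c = m.+3.
  by have := size_tuple t; rewrite et size_cat st => e; apply: (@addnI m); rewrite e; lia.
case: c et sc => [//|r c] et /= [sc].
case/lastP: c et sc => [//|c l] et; rewrite size_rcons => -[sc].
have := ab ts r (rev c) l st; rewrite size_rev => /(_ sc).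
by rewrite /kernel revK cats1 et.
Qed.

Lemma kernelP m x (a b : box (width m)) ts r bs l :
  kernel (x *: a + b) ts r bs l = x * kernel a ts r bs l + kernel b ts r bs l.
Proof. exact: eval_labelP. Qed.

Lemma kernel0 m ts r bs l : kernel (0 : box (width m)) ts r bs l = 0.
Proof.
have := kernelP (-1) 0 (0 : box (width m)) ts r bs l.
by rewrite scaler0 addr0 mulN1r addNr.
Qed.

Lemma kernel_translate m (a : box (width m)) g ts r bs l :
  kernel a (map (mulg g) ts) (g * r)%g (map (mulg g) bs) (g * l)%g = kernel a ts r bs l.
Proof.
by rewrite /kernel -[RHS](eval_label_map _ g) map_cat /= map_cat map_rev.
Qed.

Definition homogeneous_of n (a : graded) : Prop := forall m, m <> n -> a m = 0.

Lemma homogeneous_mul n i j (a b : graded) : n = (i + j)%N ->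
  homogeneous_of i a -> homogeneous_of j b ->
  homogeneous_of n (a * b) /\ (a * b) n = concat n (a i) (b j).
Proof.
move=> -> ai bj; split=> [m mij|].
  rewrite gradedME big1 // => p _.
  have [pi|pi] := eqVneq (p : nat) i; last first.
    by rewrite ai; [exact: (linear0 (concatr m _)) | exact/eqP].
  by have mi := ltn_ord p; rewrite bj ?linear0 //; lia.
rewrite gradedME.
have lti : (i < (i + j).+1)%N by rewrite ltnS leq_addr.
rewrite (bigD1 (Ordinal lti)) //= addKn big1 ?addr0 // => p ne.
rewrite ai; first exact: (linear0 (concatr _ _)).
by apply/eqP; apply: contraNN ne => /eqP pi; apply/eqP/val_inj.
Qed.

Lemma kernel_Z t r b y l :
  kernel (Z 1%N) [:: t] r [:: b; y] l = (t == l)%:R * (r == l)%:R.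
Proof.
rewrite /Z_element /= -[[:: b; y]]/(rcons [:: b] y) kernel_tangle //=.
have -> : \sum_(g : G) ([:: r; g; y] == [:: l; b; y])%:R = (r == l)%:R :> C.
  rewrite -[RHS](sum_delta b (fun=> (r == l)%:R)); apply: eq_bigr => g _.
  by rewrite !eqseq_cons !eqxx !andbT -mulnb natrM.
rewrite mulrA [_ * extremum_factor C G 2]mulrAC extremum_factorK mul1r.
have -> : (Some t == Some r) = (t == r) by [].
by case: (r =P l) => [->|_]; rewrite ?mulr0.
Qed.

Lemma homogeneous_Z : homogeneous_of 1 Z.
Proof. by move=> [|[|m]]. Qed.

Lemma homogeneous_one : homogeneous_of 0 1.
Proof. by case. Qed.

Lemma homogeneous_degree0 a : degree0 C G 3 a -> homogeneous_of 0 a.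
Proof. by move=> a0 [|m] // _; apply: a0. Qed.

Lemma kernel_one r b l : kernel ((1 : graded) 0%N) [::] r [:: b] l = (r == l)%:R.
Proof.
rewrite -[[:: b]]/(rcons [::] b) -[(1 : graded) 0%N]/(tangle (width 0) [::]).
by rewrite kernel_tangle //= !eqseq_cons !eqxx !andbT.
Qed.

Lemma kernel_mul0 n (a b : graded) ts r bs y l :
  homogeneous_of 0 a -> homogeneous_of n b -> size ts = n -> size bs = n ->
  kernel ((a * b) n) ts r (rcons bs y) l =
  \sum_(v : G) kernel (a 0%N) [::] v [:: head y bs] l * kernel (b n) ts r (rcons bs y) v.
Proof.
move=> a0 bn st sb; have [_ ->] := @homogeneous_mul n 0 n a b erefl a0 bn.
exact: (@kernel_concat _ _ n 0 n (a 0%N) (b n) [::] ts r [::] y bs l).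
Qed.

Lemma kernel_mulZ n (b : graded) t ts r c bs y l :
  homogeneous_of n b -> size ts = n -> size bs = n ->
  kernel ((Z * b) n.+1) (t :: ts) r (c :: rcons bs y) l =
  (t == l)%:R * kernel (b n) ts r (rcons bs y) l.
Proof.
move=> bn st sb; have [_ ->] := @homogeneous_mul n.+1 1 n Z b erefl homogeneous_Z bn.
have := @kernel_concat _ _ n.+1 1 n (Z 1%N) (b n) [:: t] ts r [:: c] y bs l erefl erefl st erefl sb.
rewrite [[:: t] ++ ts]/= [[:: c] ++ _]/= => ->.
under eq_bigr => v _ do rewrite kernel_Z.
rewrite -[RHS](sum_delta l (fun v => (t == l)%:R * kernel (b n) ts r (rcons bs y) v)).
by apply: eq_bigr => v _; ring.
Qed.

Definition entry (x : graded) (l r b : G) : C := kernel (x 0%N) [::] r [:: b] l.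

(** The spins [ts] are the vertices of a path starting at [l]; the i-th step of
    the path is weighted by the i-th element and the i-th bottom spin. *)
Fixpoint path_weight (xs : seq graded) (l : G) (ts bs : seq G) : C :=
  match xs, ts, bs with
  | x :: xs', t :: ts', b :: bs' => entry x l t b * path_weight xs' t ts' bs'
  | _, _, _ => 1
  end.

Lemma homogeneous_word x ys : all_in (degree0 C G 3) (x :: ys) ->
  homogeneous_of (size ys) (word Z x ys).
Proof.
elim: ys x => [|y ys IH] x [x0 yall]; first exact: homogeneous_degree0.
have [h1 _] := homogeneous_mul (esym (add1n _)) homogeneous_Z (IH y yall).
by have [] := homogeneous_mul (esym (add0n _)) (homogeneous_degree0 x0) h1.
Qed.

Lemma kernel_word x ys l ts r bs : all_in (degree0 C G 3) (x :: ys) ->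
  size ts = size ys -> size bs = (size ys).+1 ->
  kernel (word Z x ys (size ys)) ts r bs l = path_weight (x :: ys) l (rcons ts r) bs.
Proof.
elim: ys x l ts bs => [|y ys IH] x l ts bs [x0 yall].
  by case: ts => // _; case: bs => [|b [|]] //= _; rewrite mulr1.
case: ts => [//|t ts] [st]; case: bs => [//|b bs] [sb].
have hw := homogeneous_word yall.
have [hZ _] := homogeneous_mul (esym (add1n _)) homogeneous_Z hw.
case/lastP: bs sb => [//|bs c]; rewrite size_rcons => -[sb].
rewrite [word _ _ _]/= -rcons_cons (kernel_mul0 _ _ _ (homogeneous_degree0 x0) hZ) //=; first last.
- by rewrite sb.
- by rewrite st.
transitivity (\sum_(v : G) (kernel (x 0%N) [::] v [:: b] l *
    kernel (word Z y ys (size ys)) ts r (rcons bs c) v) * (v == t)%:R).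
  apply: eq_bigr => v _; rewrite kernel_mulZ // [t == v]eq_sym; ring.
rewrite (sum_delta t (fun v => kernel (x 0%N) [::] v [:: b] l *
    kernel (word Z y ys (size ys)) ts r (rcons bs c) v)).
by rewrite IH // size_rcons sb.
Qed.

Lemma homogeneous_power n : homogeneous_of n (Z ^+ n).
Proof.
elim: n => [|n IH]; first by rewrite expr0; apply: homogeneous_one.
by rewrite exprS; have [] := homogeneous_mul (esym (add1n n)) homogeneous_Z IH.
Qed.

(** In [Z ^+ n] the upper corridor is connected to all top intervals, and each
    bottom interval is isolated. *)
Lemma kernel_power n ts r bs l : size ts = n -> size bs = n.+1 ->
  kernel ((Z ^+ n) n) ts r bs l = (all (pred1 l) ts && (r == l))%:R.
Proof.
elim: n ts bs => [|n IH] ts bs.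
  by case: ts => // _; case: bs => [|b [|]] // _; rewrite expr0 kernel_one.
case: ts => [//|t ts] [st]; case: bs => [//|b bs] [sb].
case/lastP: bs sb => [//|bs c]; rewrite size_rcons => -[sb].
rewrite exprS (kernel_mulZ _ _ _ _ _ (@homogeneous_power n)) // IH ?size_rcons ?sb //=.
by rewrite -andbA -natrM mulnb.
Qed.

End Words.

(** * Recursive evaluation of closed words *)

Section Trace.

Variables (C : numClosedFieldType) (G : finGroupType).
Notation width m := (m.*2 + 3)%N.
Local Notation graded := (graded C G 3).
Local Notation Z := (Z_element C G).
Local Notation order := (order_G C G).
Local Notation P3 := (degree0 C G 3).
Local Notation path_weight := (@path_weight C G).
Implicit Types (x y : graded) (xs ys : seq graded).

Lemma path_weight_cat xs1 xs2 l ts1 ts2 bs1 bs2 :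
  size ts1 = size xs1 -> size bs1 = size xs1 ->
  path_weight (xs1 ++ xs2) l (ts1 ++ ts2) (bs1 ++ bs2) =
  path_weight xs1 l ts1 bs1 * path_weight xs2 (last l ts1) ts2 bs2.
Proof.
elim: xs1 l ts1 bs1 => [|x xs1 IH] l [|t ts1] [|b bs1] //= => [_ _|[st] [sb]].
  by rewrite mul1r.
by rewrite IH // mulrA.
Qed.

(** Partial closures of a sequence of elements of P_(3,+) along a pairing. In
    [outer_weight] the pairing is a whole diagram: there is one more element than
    nodes, and the path goes from [l] to [r] over bottom spins starting at [b].
    In [inner_weight] the elements lie under an arc of the top pairing,
    with a shaded region of spin [g] there, and the roles of top and bottom are
    exchanged: the path returns to [g] while the bottom region is unshaded. *)
Definition outer_weight (t : tree) xs (l r b : G) : C :=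
  \sum_(ts <- spins t None) \sum_(bs <- spins t (Some b))
    path_weight xs l (rcons ts r) (b :: bs).

Definition inner_weight (t : tree) xs (g : G) : C :=
  \sum_(ts <- spins t (Some g)) \sum_(bs <- spins t None) path_weight xs g ts bs.

Lemma outer_weight_leaf x l r b : outer_weight Leaf [:: x] l r b = entry x l r b.
Proof. by rewrite /outer_weight !big_seq1 /= mulr1. Qed.

Lemma inner_weight_leaf g : inner_weight Leaf [::] g = 1.
Proof. by rewrite /inner_weight !big_seq1. Qed.

Lemma sum_product (I J : Type) (r1 r2 : seq I) (s1 s2 : seq J) (c : C)
    (f h : I -> J -> C) :
  c * (\sum_(i <- r1) \sum_(j <- s1) f i j) * (\sum_(i <- r2) \sum_(j <- s2) h i j) =
  \sum_(i1 <- r1) \sum_(i2 <- r2) \sum_(j1 <- s1) \sum_(j2 <- s2)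
    c * f i1 j1 * h i2 j2.
Proof.
rewrite [c * _]mulr_sumr mulr_suml; apply: eq_bigr => i1 _.
rewrite mulr_sumr; apply: eq_bigr => i2 _.
rewrite [c * _]mulr_sumr mulr_suml; apply: eq_bigr => j1 _.
by rewrite mulr_sumr.
Qed.

(** The first arc encloses the elements [xs1]; along it the path leaves [g] and
    comes back to [g], with bottom spin [b] before and after. *)
Lemma outer_weight_node s t x xs1 xs2 l r b : size xs1 = nodes s ->
  outer_weight (Node s t) (x :: xs1 ++ xs2) l r b =
  \sum_(g : G) entry x l g b * inner_weight s xs1 g * outer_weight t xs2 g r b.
Proof.
move=> s1; rewrite {1}/outer_weight sum_spins_none; apply: eq_bigr => g _.
rewrite [RHS]sum_product big_seq [RHS]big_seq; apply: eq_bigr => ts1 ts1P.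
apply: eq_bigr => ts2 _.
rewrite sum_spins_some big_seq [RHS]big_seq; apply: eq_bigr => bs1 bs1P.
apply: eq_bigr => bs2 _.
rewrite rcons_cons rcons_cat /= path_weight_cat; first last.
- by rewrite s1 (size_spins bs1P).
- by rewrite s1 (size_spins ts1P).
by rewrite (last_spins ts1P) mulrA.
Qed.

Lemma inner_weight_node s t xs1 xs2 g : size xs1 = (nodes s).+1 ->
  inner_weight (Node s t) (xs1 ++ xs2) g =
  (\sum_(b : G) outer_weight s xs1 g g b) * inner_weight t xs2 g.
Proof.
move=> s1; rewrite {1}/inner_weight sum_spins_some mulr_suml.
transitivity (\sum_(ts1 <- spins s None) \sum_(ts2 <- spins t (Some g)) \sum_(b : G)
  \sum_(bs1 <- spins s (Some b)) \sum_(bs2 <- spins t None)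
    1 * path_weight xs1 g (rcons ts1 g) (b :: bs1) * path_weight xs2 g ts2 bs2).
  rewrite big_seq [RHS]big_seq; apply: eq_bigr => ts1 ts1P; apply: eq_bigr => ts2 _.
  rewrite sum_spins_none; apply: eq_bigr => b _.
  rewrite big_seq [RHS]big_seq; apply: eq_bigr => bs1 bs1P; apply: eq_bigr => bs2 _.
  rewrite -cat_rcons -cat_cons path_weight_cat; first last.
  - by rewrite s1 /= (size_spins bs1P).
  - by rewrite s1 size_rcons (size_spins ts1P).
  by rewrite last_rcons mul1r.
under eq_bigr => ts1 _ do rewrite exchange_big.
rewrite exchange_big; apply: eq_bigr => b _ /=.
by rewrite -sum_product mul1r.
Qed.

Lemma entry_translate x k l r b : entry x (k * l)%g (k * r)%g (k * b)%g = entry x l r b.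
Proof. exact: (kernel_translate (x 0%N) k [::] r [:: b] l). Qed.

(** Invariance of the labels under translation. Consequently [inner_weight] is a
    constant, and so is the sum of [outer_weight] over the bottom spin when both
    ends of the path agree: this is where the irreducibility of the planar algebra
    enters. *)
Lemma weight_translate k t :
  (forall xs l r b, size xs = (nodes t).+1 ->
     outer_weight t xs (k * l)%g (k * r)%g (k * b)%g = outer_weight t xs l r b) /\
  (forall xs g, size xs = nodes t -> inner_weight t xs (k * g)%g = inner_weight t xs g).
Proof.
elim: t => [|s [so si] t [to ti]].
  split=> [[|x [|x' xs]] l r b|[|x xs] g] /= e; try discriminate e.
    by rewrite !outer_weight_leaf entry_translate.
  by rewrite !inner_weight_leaf.
split=> [[|x xs] //= l r b [sx]|xs g /= sx].
  have e : xs = take (nodes s) xs ++ drop (nodes s) xs by rewrite cat_take_drop.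
  have s1 : size (take (nodes s) xs) = nodes s by rewrite size_takel // sx; lia.
  have s2 : size (drop (nodes s) xs) = (nodes t).+1 by rewrite size_drop sx; lia.
  rewrite e !outer_weight_node // (reindex_inj (mulgI k)) /=.
  by apply: eq_bigr => g _; rewrite entry_translate si ?to.
have e : xs = take (nodes s).+1 xs ++ drop (nodes s).+1 xs by rewrite cat_take_drop.
have s1 : size (take (nodes s).+1 xs) = (nodes s).+1 by rewrite size_takel // sx; lia.
have s2 : size (drop (nodes s).+1 xs) = nodes t by rewrite size_drop sx; lia.
rewrite e !inner_weight_node // ti //; congr (_ * _).
by rewrite (reindex_inj (mulgI k)) /=; apply: eq_bigr => b _; rewrite so.
Qed.

Definition outer_value t xs : C := order ^- 2 * \sum_(g : G) \sum_(b : G) outer_weight t xs g g b.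
Definition inner_value t xs : C := inner_weight t xs 1%g.

Lemma inner_weightE t xs g : size xs = nodes t -> inner_weight t xs g = inner_value t xs.
Proof. by move=> sx; rewrite -[g in LHS]mulg1 (weight_translate g t).2. Qed.

Lemma sum_outer_weight t xs g : size xs = (nodes t).+1 ->
  \sum_(b : G) outer_weight t xs g g b = order * outer_value t xs.
Proof.
move=> sx; pose S g := \sum_(b : G) outer_weight t xs g g b.
have SE h : S h = S g.
  rewrite /S [RHS](reindex_inj (mulgI (g * h^-1)%g)) /=; apply: eq_bigr => b _.
  by rewrite -(weight_translate (g * h^-1)%g t).1 // mulgKV.
rewrite /outer_value -/(S g) (eq_bigr (fun=> S g)) => [|h _]; last exact: SE.
rewrite sumr_const -mulr_natl cardT -cardE -/order.
by field; apply: order_neq0.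
Qed.

Lemma inner_value_node s t xs1 xs2 : size xs1 = (nodes s).+1 -> size xs2 = nodes t ->
  inner_value (Node s t) (xs1 ++ xs2) = order * outer_value s xs1 * inner_value t xs2.
Proof. by move=> s1 s2; rewrite /inner_value inner_weight_node // sum_outer_weight. Qed.

Lemma entry_mul x y l r b : P3 x -> P3 y ->
  entry (x * y) l r b = \sum_(g : G) entry x l g b * entry y g r b.
Proof.
move=> x0 y0.
exact: (@kernel_mul0 C G 0 x y [::] r [::] b l (homogeneous_degree0 x0) (homogeneous_degree0 y0)).
Qed.

Lemma outer_weight_mul t x y ys l r b : P3 x -> P3 y ->
  outer_weight t (x * y :: ys) l r b =
  \sum_(g : G) entry x l g b * outer_weight t (y :: ys) g r b.
Proof.
move=> x0 y0; rewrite /outer_weight.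
under [RHS]eq_bigr do rewrite mulr_sumr.
rewrite [RHS]exchange_big; apply: eq_bigr => ts _ /=.
under [RHS]eq_bigr do rewrite mulr_sumr.
rewrite [RHS]exchange_big; apply: eq_bigr => bs _ /=.
case: ts => [|t' ts] /=; rewrite entry_mul // mulr_suml;
  by apply: eq_bigr => g _; rewrite mulrA.
Qed.

Lemma outer_value_node s t x xs1 y xs2 : P3 x -> P3 y ->
  size xs1 = nodes s -> size xs2 = nodes t ->
  outer_value (Node s t) (x :: xs1 ++ y :: xs2) =
  inner_value s xs1 * outer_value t (x * y :: xs2).
Proof.
move=> x0 y0 s1 s2; rewrite /outer_value mulrCA; congr (_ * _).
rewrite mulr_sumr; apply: eq_bigr => g _; rewrite mulr_sumr; apply: eq_bigr => b _.
rewrite outer_weight_node // outer_weight_mul // mulr_sumr; apply: eq_bigr => h _.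
by rewrite inner_weightE //; ring.
Qed.

End Trace.

(** * The Schwinger-Dyson equation for the trace *)

Section SchwingerDyson.

Variables (C : numClosedFieldType) (G : finGroupType).
Notation width m := (m.*2 + 3)%N.
Local Notation graded := (graded C G 3).
Local Notation Z := (Z_element C G).
Local Notation order := (order_G C G).
Local Notation P3 := (degree0 C G 3).
Implicit Types (x y : graded) (xs ys : seq graded).

Lemma all_in_take n xs : all_in P3 xs -> all_in P3 (take n xs).
Proof. by elim: xs n => [|x xs IH] [|n] //= [x0 /IH]. Qed.

Lemma all_in_drop n xs : all_in P3 xs -> all_in P3 (drop n xs).
Proof. by elim: xs n => [|x xs IH] [|n] //= [x0 /IH]. Qed.

Lemma all_in_nth n xs : all_in P3 xs -> P3 (nth 1 xs n).
Proof.
elim: xs n => [|x xs IH] n; first by rewrite nth_nil => _; apply: (subalgebra1 P3).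
by case: n => [|n] [x0 xs0] //; apply: IH.
Qed.

(** The trace of a word, and the total weight of the diagrams that can fill the
    inside of an arc enclosing [xs]. *)
Definition moment xs : C := \sum_(t <- trees (size xs).-1) outer_value t xs.
Definition inner_moment xs : C := \sum_(t <- trees (size xs)) inner_value t xs.

Lemma inner_moment_nil : inner_moment [::] = 1.
Proof. by rewrite /inner_moment big_seq1 /inner_value inner_weight_leaf. Qed.

(** The arc of the first top point encloses the first [i] elements. Once it is
    removed, [x] is multiplied by the next element. *)
Lemma moment_first x ys : P3 x -> all_in P3 ys -> (0 < size ys)%N ->
  moment (x :: ys) = \sum_(i < size ys)
    inner_moment (take i ys) * moment (x * nth 1 ys i :: drop i.+1 ys).
Proof.
move=> x0 ys0; rewrite /moment /=; case en: (size ys) => [//|n] _.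
rewrite big_trees; apply: eq_bigr => i _; have lti := ltn_ord i.
have st : size (take i ys) = i by rewrite size_takel // en ltnW.
have sd : size (drop i.+1 ys) = (n - i)%N by rewrite size_drop en subSS.
have eys : ys = take i ys ++ nth 1 ys i :: drop i.+1 ys.
  by rewrite -drop_nth ?cat_take_drop // en.
rewrite /inner_moment st /= sd mulr_suml big_seq [RHS]big_seq.
apply: eq_bigr => a; rewrite mem_trees => /eqP ea.
rewrite mulr_sumr big_seq [RHS]big_seq.
apply: eq_bigr => b; rewrite mem_trees => /eqP eb.
by rewrite {1}eys outer_value_node ?st ?sd //; apply: all_in_nth.
Qed.

Lemma inner_moment_first ys : (0 < size ys)%N ->
  inner_moment ys = order * \sum_(i < size ys)
    moment (take i.+1 ys) * inner_moment (drop i.+1 ys).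
Proof.
rewrite /inner_moment; case en: (size ys) => [//|n] _.
rewrite big_trees mulr_sumr; apply: eq_bigr => i _; have lti := ltn_ord i.
have st : size (take i.+1 ys) = i.+1 by rewrite size_takel // en.
have sd : size (drop i.+1 ys) = (n - i)%N by rewrite size_drop en subSS.
rewrite /moment st /= sd mulr_suml mulr_sumr big_seq [RHS]big_seq.
apply: eq_bigr => a; rewrite mem_trees => /eqP ea.
rewrite !mulr_sumr big_seq [RHS]big_seq.
apply: eq_bigr => b; rewrite mem_trees => /eqP eb.
by rewrite -{1}(cat_take_drop i.+1 ys) inner_value_node ?st ?sd ?ea ?eb // mulrA.
Qed.

(** The decomposition along the last arc instead of the first one. With [F] and
    [R] the matrices of the values of [moment] and [inner_moment] on the
    intervals of [ys], [inner_moment_first] says that [R] is a right inverse of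
    [1 - order *: F]. A right inverse of a square matrix is a left inverse, which
    is the decomposition from the other end. *)
Lemma inner_moment_last ys : (0 < size ys)%N ->
  inner_moment ys = order * \sum_(i < size ys)
    inner_moment (take i ys) * moment (drop i ys).
Proof.
set N := size ys => N_gt0.
pose seg i j := take (j - i) (drop i ys).
pose F : 'M[C]_N.+1 := \matrix_(i, j) if (i < j)%N then moment (seg i j) else 0.
pose R : 'M[C]_N.+1 := \matrix_(i, j) if (i <= j)%N then inner_moment (seg i j) else 0.
have FR : (1%:M - order *: F) *m R = 1%:M.
  rewrite mulmxBl mul1mx -scalemxAl; apply/matrixP => i j; rewrite !mxE.
  have [ltij|leji] := ltnP i j; last first.
    rewrite big1 ?mulr0 ?subr0 => [|k _].
      rewrite -val_eqE /=; case: ltngtP leji => // ij _.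
      rewrite -ij.
      by rewrite /seg subnn take0 inner_moment_nil.
    rewrite !mxE; case: ltnP => ik; last by rewrite mul0r.
    by rewrite leqNgt (leq_ltn_trans leji ik) mulr0.
  rewrite (ltnW ltij) -val_eqE /= (ltn_eqF ltij).
  have sseg : size (seg i j) = (j - i)%N.
    by rewrite size_takel // size_drop -/N leq_sub2r // -ltnS.
  rewrite inner_moment_first ?sseg ?subn_gt0 //; apply/eqP; rewrite subr_eq0; apply/eqP.
  congr (_ * _).
  pose H (k : nat) := moment (seg i k) * inner_moment (seg k j).
  transitivity (\sum_(i.+1 <= k < j.+1) H k).
    have -> : \sum_(i.+1 <= k < j.+1) H k = \sum_(k < j - i) H (k + i.+1)%N.
      by rewrite -{1}[i.+1]add0n big_addn subSS big_mkord.
    apply: eq_bigr => p _; have ltp := ltn_ord p; congr (moment _ * inner_moment _).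
      by rewrite /seg take_takel //; congr take; lia.
    rewrite /seg !take_drop drop_drop !subnK; try lia.
    by congr drop; lia.
  rewrite (big_nat_widen _ _ N.+1) // (big_nat_widenl _ 0) // big_mkord big_mkcond /=.
  apply: eq_bigr => k _; rewrite !mxE ltnS.
  by case: (i < k)%N; case: (k <= j)%N; rewrite ?mul0r ?mulr0 //.
have /matrixP/(_ ord0 ord_max) := mulmx1C FR.
rewrite mulmxBr mulmx1 -scalemxAr !mxE -val_eqE /= (ltn_eqF N_gt0) => /eqP.
rewrite subr_eq0 /seg subn0 drop0 take_size => /eqP ->; congr (_ * _).
rewrite big_ord_recr /= !mxE ltnn mulr0 addr0; apply: eq_bigr => i _.
rewrite !mxE /= ltn_ord /seg subn0 drop0; congr (_ * moment _).
by rewrite take_oversize // size_drop.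
Qed.

(** Rotating a diagram by one string: the inside of an arc, closed up on itself,
    is the diagram of the same word with one more [Z]. *)
Lemma inner_momentE ys : all_in P3 ys -> (0 < size ys)%N ->
  inner_moment ys = order * moment (1 :: ys).
Proof.
move=> ys0 ysN; rewrite inner_moment_last // moment_first //; last exact: (subalgebra1 P3).
congr (_ * _); apply: eq_bigr => i _; congr (_ * moment _).
by rewrite mul1r -drop_nth.
Qed.

Definition closure_sum m (a : box C G (width m)) : C :=
  \sum_(T | noncrossing_pairing T) closure_value a T.

Lemma closure_sumE m (a : box C G (width m)) :
  closure_sum a = (sqrtC order)^-1 *
    \sum_(t <- trees m) \sum_(r : G) \sum_(ts <- spins t None)
      \sum_(y : G) \sum_(bs <- spins t (Some y)) kernel a ts r (y :: bs) r.
Proof.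
transitivity (\sum_(T : {ffun 'I_(m.*2) -> 'I_(m.*2)} | noncrossing_pairing T)
    closure_along a (openings T)); first by [].
rewrite sum_noncrossing_pairings mulr_sumr big_seq [RHS]big_seq.
by apply: eq_bigr => t; rewrite mem_trees => /eqP/closure_alongE->.
Qed.

Lemma closure_sum_linear m : scalar (@closure_sum m).
Proof.
move=> k a b; rewrite !closure_sumE mulrCA -mulrDr; congr (_ * _).
rewrite mulr_sumr -big_split; apply: eq_bigr => t _ /=.
rewrite mulr_sumr -big_split; apply: eq_bigr => r _ /=.
rewrite mulr_sumr -big_split; apply: eq_bigr => ts _ /=.
rewrite mulr_sumr -big_split; apply: eq_bigr => y _ /=.
rewrite mulr_sumr -big_split; apply: eq_bigr => bs _ /=.
by rewrite kernelP.
Qed.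

Lemma closure_sum0 m : closure_sum (0 : box C G (width m)) = 0.
Proof.
have := closure_sum_linear (-1) 0 (0 : box C G (width m)).
by rewrite scaler0 addr0 mulN1r addNr.
Qed.

Lemma graded_trace_bound M (a : graded) : (forall m, (M <= m)%N -> a m = 0) ->
  graded_trace a = sqrtC order ^- 3 * \sum_(m < M) closure_sum (a m).
Proof.
move=> aM; rewrite /graded_trace; congr (_ * _).
rewrite (fsbig_ord _ _ (fun m => closure_sum (a m))) -(fsbig_widen `I_M setT) // => m /= [_ /negP].
by rewrite -leqNgt => /aM-> /=; apply: closure_sum0.
Qed.

Lemma graded_trace_homogeneous n (a : graded) : homogeneous_of n a ->
  graded_trace a = sqrtC order ^- 3 * closure_sum (a n).
Proof.
move=> an; rewrite (@graded_trace_bound n.+1) => [|m mn]; last first.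
  by rewrite an // => mn'; rewrite mn' ltnn in mn.
rewrite big_ord_recr /= big1 ?add0r // => i _.
by rewrite an ?closure_sum0 // => e; have := ltn_ord i; rewrite e ltnn.
Qed.

Lemma graded_trace_linear : scalar (@graded_trace C G 3).
Proof.
move=> k a b; have [M aM] := graded_fin a; have [N bN] := graded_fin b.
have geM m : (maxn M N <= m)%N -> a m = 0 /\ b m = 0.
  by rewrite geq_max => /andP[/aM-> /bN->].
rewrite !(@graded_trace_bound (maxn M N)); first last.
- by move=> m /geM[am bm]; rewrite componentD componentZ am bm scaler0 addr0.
- by move=> m /geM[am bm].
- by move=> m /geM[am bm].
rewrite [in RHS]mulrCA -mulrDr; congr (_ * _).
rewrite mulr_sumr -big_split; apply: eq_bigr => m _ /=.
exact: closure_sum_linear.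
Qed.

Lemma graded_trace_word x ys : all_in P3 (x :: ys) ->
  graded_trace (word Z x ys) = moment (x :: ys).
Proof.
move=> xs0; rewrite (graded_trace_homogeneous (homogeneous_word xs0)) closure_sumE.
rewrite mulrA /moment mulr_sumr big_seq [RHS]big_seq; apply: eq_bigr => t.
rewrite mem_trees => /eqP et; rewrite /outer_value.
have -> : sqrtC order ^- 3 / sqrtC order = order ^- 2.
  by rewrite -invfM -exprSr -[in RHS](sqrtCK order) -exprM.
congr (_ * _); apply: eq_bigr => r _; rewrite exchange_big; apply: eq_bigr => y _ /=.
rewrite /outer_weight big_seq [RHS]big_seq; apply: eq_bigr => ts /size_spins sts.
rewrite big_seq [RHS]big_seq; apply: eq_bigr => bs /size_spins sbs.
by rewrite kernel_word //= ?sts ?sbs ?et.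
Qed.

Lemma big_splits x ys (F : graded * graded -> C) :
  \sum_(p <- splits Z x ys) F p = \sum_(i < size ys)
    F (word Z x (take i ys), word Z (nth 1 ys i) (drop i.+1 ys)).
Proof.
elim: ys x F => [|y ys IH] x F; first by rewrite big_nil big_ord0.
rewrite [splits _ _ _]/= big_cons big_map big_ord_recl /= drop0; congr (_ + _).
by rewrite (IH _ (fun p => F (x * (Z * p.1), p.2))).
Qed.

(** The term of [moment_first] with an empty interior merges [x] with [y]; in the
    others, the interior is the trace of a word starting with [Z], by
    [inner_momentE]. *)
Lemma graded_trace_SD : schwinger_dyson P3 (@graded_trace C G 3) Z order.
Proof.
move=> x y ys x0 yys0; have [y0 ys0] := yys0.
have P31 := subalgebra1 P3.
rewrite -[x * (Z * _)]/(word Z x (y :: ys)) graded_trace_word //.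
have mul_word u v vs : u * word Z v vs = word Z (u * v) vs by case: vs => //= *; rewrite mulrA.
rewrite moment_first // [size _]/= big_ord_recl; congr (_ + _).
  rewrite mul_word graded_trace_word; last by split=> //; apply: subalgebraM.
  by rewrite /= drop0 inner_moment_nil mul1r.
rewrite big_splits mulr_sumr; apply: eq_bigr => i _.
rewrite lift0 /= inner_momentE //; last first.
  by split=> //; apply: all_in_take.
rewrite [x * _]mul_word -mulrA.
have -> : Z * word Z y (take i ys) = word Z 1 (y :: take i ys) by rewrite /= mul1r.
have pre0 : all_in P3 [:: 1, y & take i ys] by do 2!split=> //; apply: all_in_take.
have suf0 : all_in P3 (x * nth 1 ys i :: drop i.+1 ys).
  by split; [apply: subalgebraM => //; apply: all_in_nth | apply: all_in_drop].
by rewrite (graded_trace_word pre0) (graded_trace_word suf0).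
Qed.

Lemma graded_trace1 : graded_trace (1 : graded) = 1.
Proof.
have P31 := subalgebra1 P3.
rewrite -[1 in LHS]/(word Z 1 [::]) graded_trace_word //.
rewrite /moment big_seq1 /outer_value.
under eq_bigr => g _.
  under eq_bigr do rewrite outer_weight_leaf /entry kernel_one eqxx.
  rewrite sumr_const.
  over.
rewrite sumr_const -mulrnA natrM cardT -cardE -/order.
by field; apply: order_neq0.
Qed.

End SchwingerDyson.

(** * The involution and polynomials in Z *)

Section Dagger.

Variables (C : numClosedFieldType) (G : finGroupType).
Notation width m := (m.*2 + 3)%N.
Local Notation box := (box C G).
Local Notation graded := (graded C G 3).
Local Notation Z := (Z_element C G).

(** The nested caps to the right of a box in the picture of the involution
    create, from the shaded interval [y] at their left, the spins [gs] and then
    the same spins in reverse order. *)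
Lemma state_sum_right_caps p q w c1 y c2 d : odd p -> size c1 = p./2 ->
  state_sum ([seq Cap C G (p + j) | j <- iota 0 q.*2] ++ w) (c1 ++ y :: c2) d =
  \sum_(gs : q.-tuple G)
    state_sum w (c1 ++ (y :: gs) ++ rev (belast y gs) ++ c2) d.
Proof.
elim: q p c1 y c2 => [|q IH] p c1 y c2 op sc.
  rewrite (eq_bigr (fun=> state_sum w (c1 ++ y :: c2) d)) => [|e _]; last by rewrite tuple0.
  by rewrite sumr_const cardT -cardE card_tuple expn0.
rewrite (sum_tuple_cons _ (fun gs => state_sum w (c1 ++ (y :: gs) ++ rev (belast y gs) ++ c2) d)).
have -> : [seq Cap C G (p + j) | j <- iota 0 q.+1.*2] =
    Cap C G p :: Cap C G p.+1 :: [seq Cap C G (p.+2 + j) | j <- iota 0 q.*2].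
  rewrite doubleS /= addn0 addn1 (iotaDl 2 0) -map_comp; congr [:: _, _ & _].
  by apply: eq_map => j /=; rewrite !addSn !addnS.
have take1 : take p./2.+1 (c1 ++ y :: c2) = rcons c1 y.
  by rewrite -sc -cat_rcons take_size_cat ?size_rcons.
have drop1 : drop p./2 (c1 ++ y :: c2) = y :: c2 by rewrite -sc drop_size_cat.
have sc' : size (rcons c1 y) = uphalf p by rewrite size_rcons sc; lia.
rewrite !cat_cons /= op /= take1 drop1 -sc' take_size_cat // drop_size_cat //.
rewrite mulrA extremum_factorK mul1r; apply: eq_bigr => g _.
rewrite IH /= ?op //; last by rewrite size_rcons sc.
by apply: eq_bigr => gs _; rewrite rev_cons !cat_rcons.
Qed.

(** The nested cups to the left of the box match the top spins [ts] with the
    reversed left part of the bottom line of the box. *)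
Lemma state_sum_left_cups ts w c d : (size ts <= size c)%N ->
  state_sum (rev [seq Cup C G j | j <- iota 0 (size ts).*2] ++ w) (ts ++ c) d =
  (take (size ts) c == rev ts)%:R * state_sum w (drop (size ts) c) d.
Proof.
elim/last_ind: ts c => [|ts t IH] c sc.
  by rewrite take0 drop0 mul1r.
case: c sc => [|h c]; first by rewrite size_rcons.
rewrite size_rcons ltnS => sc.
have -> : rev [seq Cup C G j | j <- iota 0 (size ts).+1.*2] =
    [:: Cup C G (size ts).*2.+1, Cup C G (size ts).*2 & rev [seq Cup C G j | j <- iota 0 (size ts).*2]].
  by rewrite doubleS -addn2 iotaD map_cat rev_cat.
have half2 : uphalf (size ts).*2 = size ts by lia.
have takec : take (size ts) (rcons ts t ++ h :: c) = ts by rewrite cat_rcons take_size_cat.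
have dropc : drop (size ts).+1 (rcons ts t ++ h :: c) = h :: c.
  by rewrite drop_size_cat ?size_rcons.
have onth1 : onth (rcons ts t ++ h :: c) (size ts) = Some t by elim: (ts).
have onth2 : onth (rcons ts t ++ h :: c) (size ts).+1 = Some h by elim: (ts).
rewrite rev_rcons [take _ _]/= [drop _ _]/= eqseq_cons.
rewrite !cat_cons; set v := rev _ ++ w.
have -> : state_sum (Cup C G (size ts).*2.+1 :: Cup C G (size ts).*2 :: v)
    (rcons ts t ++ h :: c) d =
  extremum_factor C G (size ts).*2.+1 * (Some t == Some h)%:R *
  (extremum_factor C G (size ts).*2 * 1 * state_sum v (ts ++ c) d).
  rewrite /= odd_double /= half2 onth1; move: onth2 => /= ->.
  by rewrite doubleK takec; move: dropc => /= ->; rewrite take_size_cat // -cat_rcons drop_size_cat ?size_rcons.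
rewrite /v IH //; have := extremum_factorK C G (size ts).*2 => ff.
have -> : (Some t == Some h) = (h == t) by rewrite eq_sym.
rewrite -mulnb natrM -[RHS]mul1r -[X in _ = X * _]ff; ring.
Qed.

Lemma eval_label_adjoint n (f : box n) s : eval_label (adjoint f) s = (eval_label f (rev s))^*.
Proof.
rewrite /eval_label; case: (boolP (size s == n)) => [sn|snN]; last first.
  by rewrite !insubF /= ?conjC0 // ?size_rev; apply/negbTE.
have -> : s = Tuple sn by [].
have -> : rev (Tuple sn) = rev_tuple (Tuple sn) by [].
by rewrite !valK /= ffunE.
Qed.

(** The involution reflects the box in a vertical axis, hence reverses the top
    and the bottom and exchanges left and right. *)
Lemma kernel_dagger m (a : graded) ts r bs l : size ts = m -> size bs = m.+1 ->
  kernel (dagger a m) ts r bs l = (kernel (a m) (rev ts) l (rev bs) r)^*.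
Proof.
move=> st; case/lastP: bs => [//|bs y]; rewrite size_rcons => -[sb].
rewrite [dagger a m]/= kernel_tangle // /dagger_tangle -[ts ++ [:: r; y]]cat_rcons.
rewrite state_sum_right_caps; first last.
- by rewrite size_rcons st; lia.
- by rewrite oddD odd_double.
(* [e] is the bottom line of the reflected box, [gs] its spins under the caps. *)
pose K e gs := eval_label (adjoint (a m)) ((r :: y :: gs) ++ rev e).
transitivity (\sum_(gs : m.-tuple G) K (rcons (rev ts) l) gs * (val gs == rev bs)%:R).
  apply: eq_bigr => gs _.
  have -> : rcons ts r ++ (y :: gs) ++ rev (belast y gs) ++ [::] =
     ts ++ (r :: belast y gs) ++ last y gs :: rev (belast y gs).
    by rewrite cats0 cat_rcons [in RHS]cat_cons -[belast y gs ++ _]cat_rcons -lastI.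
  have szx : size (r :: belast y gs) = m.+1 by rewrite /= size_belast size_tuple.
  rewrite cat1s state_sum_Box //.
  rewrite (sum_tuple_rcons _ (fun e => eval_label (adjoint (a m))
    (rcons (r :: belast y gs) (last y gs) ++ rev e) *
    state_sum (rev [seq Cup C G j | j <- iota 0 m.*2])
      (ts ++ e ++ last y gs :: rev (belast y gs)) (l :: rcons bs y))).
  have lastE : rcons (r :: belast y gs) (last y gs) = r :: y :: gs.
    by rewrite rcons_cons -lastI.
  have revE : last y gs :: rev (belast y gs) = rcons (rev gs) y.
    by rewrite -rev_rcons -lastI rev_cons.
  transitivity (\sum_(v : G) \sum_(e : m.-tuple G)
      (K (rcons e v) gs * (val gs == rev bs)%:R * (v == l)%:R) * (val e == rev ts)%:R).
    apply: eq_bigr => v _; apply: eq_bigr => e _.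
    have := @state_sum_left_cups ts [::] (rcons e v ++ rcons (rev gs) y) (l :: rcons bs y).
    rewrite cats0 st lastE revE => ->; last by rewrite size_cat size_rcons size_tuple; lia.
    rewrite cat_rcons take_size_cat ?size_tuple // drop_size_cat ?size_tuple // /=.
    rewrite eqseq_cons eqseq_rcons eqxx andbT (can2_eq revK revK).
    by rewrite -mulnb natrM /K; ring.
  transitivity (\sum_(v : G) (K (rcons (rev ts) v) gs * (val gs == rev bs)%:R) * (v == l)%:R).
    apply: eq_bigr => v _.
    by rewrite (sum_tuple_delta (fun e => K (rcons e v) gs * (val gs == rev bs)%:R * (v == l)%:R)) ?size_rev.
  by rewrite (sum_delta l (fun v => K (rcons (rev ts) v) gs * (val gs == rev bs)%:R)).
rewrite (sum_tuple_delta (K (rcons (rev ts) l))) ?size_rev // /K eval_label_adjoint.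
congr (eval_label _ _)^*.
by rewrite rev_cat revK !rev_cons !revK cat_rcons cats1.
Qed.

Lemma dagger_power n : dagger (Z ^+ n) = Z ^+ n.
Proof.
have hom := @homogeneous_power C G n.
apply: gradedP => m; have [-> |mn] := eqVneq m n; last first.
  rewrite [RHS]hom; last exact/eqP.
  apply: kernel_inj => ts r bs l st sb; rewrite kernel_dagger // hom; last exact/eqP.
  by rewrite !kernel0 conjC0.
apply: kernel_inj => ts r bs l st sb.
rewrite kernel_dagger // !kernel_power ?size_rev // rmorph_nat all_rev.
by have [->|] := eqVneq l r; rewrite ?andbF.
Qed.

Lemma dagger_conj_linear k (a b : graded) :
  dagger (k *: a + b) = k^* *: dagger a + dagger b.
Proof.
apply: gradedP => m; apply: kernel_inj => ts r bs l st sb.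
rewrite componentD componentZ kernelP !kernel_dagger //.
by rewrite componentD componentZ kernelP rmorphD rmorphM.
Qed.

Definition polynomials : unital_subalgebra graded.
Proof.
exists (fun a => exists p : {poly C}, a = horner_alg Z p) => [|x _ _ [p ->] [q ->]|_ _ [p ->] [q ->]].
- by exists 1; rewrite rmorph1.
- by exists (x *: p + q); rewrite linearP /= mulr_algl.
- by exists (p * q); rewrite rmorphM.
Defined.

Lemma horner_algE (p : {poly C}) : horner_alg Z p = \sum_(k < size p) p`_k *: Z ^+ k.
Proof.
rewrite -{1}[p]coefK poly_def linear_sum; apply: eq_bigr => k _ /=.
by rewrite linearZ /= rmorphXn /= horner_algX mulr_algl.
Qed.

(** Polynomials in [Z] form a subalgebra that contains [Z], and it is stable under
    the involution since all powers of [Z] are self-adjoint. *)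
Lemma star_generated_polynomial a : star_generated (@dagger C G 3) Z a ->
  exists N, polynomial_in Z N a.
Proof.
move/(_ polynomials) => [].
- move=> _ [p ->]; exists (map_poly Num.conj p).
  rewrite !horner_algE size_map_poly.
  have dagger0 : dagger (0 : graded) = 0.
    by have := dagger_conj_linear (-1) 0 0; rewrite scaler0 addr0 rmorphN1 scaleN1r addNr.
  have daggerD u v : dagger (u + v : graded) = dagger u + dagger v.
    by have := dagger_conj_linear 1 u v; rewrite rmorph1 !scale1r.
  rewrite (big_morph _ daggerD dagger0); apply: eq_bigr => k _.
  have := dagger_conj_linear p`_k (Z ^+ k) 0.
  by rewrite dagger0 !addr0 dagger_power coef_map.
- by exists 'X; rewrite horner_algX.
- by move=> p ->; exists (size p), (fun k => p`_k); rewrite horner_algE.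
Qed.

End Dagger.

(** * Freeness *)

Theorem proposition9 (R : realType) (G : finGroupType) (ntG : (1 < #|G|)%N) :
  free_pair (@graded_trace R[i] G 3)
    (star_generated (@dagger R[i] G 3) (Z_element R[i] G)) (degree0 R[i] G 3).
Proof.
apply: (free_of_schwinger_dyson _ _ (@graded_trace_SD R[i] G)).
- exact: graded_trace_linear.
- exact: graded_trace1.
- exact: star_generated_polynomial.
Qed.
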